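(* Let $X$ and $Y$ be two real Banach spaces such that, for every $\varepsilon>0$, there exists a (not necessarily linear) bi-Lipschitz bijection $\phi_\varepsilon:X\to Y$ with $\Vert\phi_\varepsilon\Vert\,\Vert\phi_\varepsilon^{-1}\Vert\leq 1+\varepsilon$. If $X$ is an $L_1$-predual, then $Y$ is an $L_1$-predual.
   Context: All Banach spaces are real. A Banach space $X$ is an $L_1$-predual if $X^*$ is linearly isometric to $L_1(\mu)$ for some measure $\mu$. For a Lipschitz map $g$ between Banach spaces, $\Vert g\Vert$ denotes its best Lipschitz constant, $\Vert g\Vert:=\sup\{\Vert g(x)-g(y)\Vert/\Vert x-y\Vert: x\neq y\}$. A bijection $\phi$ is bi-Lipschitz if both $\phi$ and $\phi^{-1}$ are Lipschitz. *)

(* Defs.v *)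
From HB Require Import structures.
From mathcomp Require Import all_boot all_order all_algebra.
From mathcomp Require Import all_classical all_reals all_analysis.
From mathcomp Require Import measurable_realfun.

Set Implicit Arguments.
Unset Strict Implicit.
Unset Printing Implicit Defensive.

Import Order.TTheory GRing.Theory Num.Theory.
Import numFieldNormedType.Exports.

Local Open Scope classical_set_scope.
Local Open Scope ring_scope.

Section dual_space.
Context {R : realType} (X : normedModType R).

Definition continuous_functional : {pred X -> R^o} :=
  mem [set f : X -> R^o | linear f /\ continuous f].

Lemma continuous_functional_submod : submod_closed continuous_functional.
Proof.
split.
  rewrite inE; split; first by move=> a x y; rewrite /= scaler0 addr0.
  exact: cst_continuous.
move=> a f g /[!inE] -[lf cf] [lg cg]; split.
  move=> b x y; rewrite !fctE lf lg /GRing.scale/=.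
  by rewrite !mulrDr !mulrA [a * b]mulrC addrACA.
move=> x; apply: (@continuousD _ R^o); last exact: cg.
by apply: (@cvgM R _ _ _ (cst a) f); [exact: cvg_cst|exact: cf].
Qed.

HB.instance Definition _ := GRing.isSubmodClosed.Build R (X -> R^o)
  continuous_functional continuous_functional_submod.

Record dual := Dual {
  dual_fun :> X -> R^o;
  dual_funP : dual_fun \in continuous_functional }.

HB.instance Definition _ := [isSub for dual_fun].
HB.instance Definition _ := [Choice of dual by <:].
HB.instance Definition _ := [SubChoice_isSubLmodule of dual by <:].

Definition dual_norm (f : dual) : R :=
  sup [set `|f x| | x in [set x : X | `|x| <= 1]].

Lemma dualD (f g : dual) x : (f + g) x = f x + g x.
Proof. by []. Qed.

Lemma dualZ a (f : dual) x : (a *: f) x = a * f x.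
Proof. by []. Qed.

Lemma dual_linear (f : dual) : linear f.
Proof. by have := dual_funP f; rewrite inE => -[]. Qed.

Lemma dual_continuous (f : dual) : continuous f.
Proof. by have := dual_funP f; rewrite inE => -[]. Qed.

Lemma dual_bounded (f : dual) : exists M, forall x, `|f x| <= M * `|x|.
Proof.
pose F : {linear X -> R^o} :=
  HB.pack (f : X -> R^o) (GRing.isLinear.Build _ _ _ _ _ (dual_linear f)).
have /linear_boundedP/pinfty_ex_gt0[M _ fM] : bounded_near F (nbhs (0 : X)).
  by apply: continuous_linear_bounded; exact: dual_continuous.
by exists M.
Qed.

Lemma dual_norm_has_sup (f : dual) :
  has_sup [set `|f x| | x in [set x : X | `|x| <= 1]].
Proof.
split; first by exists `|f 0|, 0; rewrite //= normr0.
have [M fM] := dual_bounded f; exists `|M| => _ [x /= x1 <-].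
apply: (le_trans (fM x)); apply: (le_trans (ler_norm _)).
by rewrite normrM normr_id ler_piMr.
Qed.

Lemma dual_norm_ub (f : dual) x : `|x| <= 1 -> `|f x| <= dual_norm f.
Proof. by move=> x1; apply: (ub_le_sup (dual_norm_has_sup f).2); exists x. Qed.

Lemma dual_norm_le (f : dual) M :
  (forall x, `|x| <= 1 -> `|f x| <= M) -> dual_norm f <= M.
Proof.
move=> fM; apply: ge_sup; first exact: (dual_norm_has_sup f).1.
by move=> _ [x /= x1 <-]; exact: fM.
Qed.

Lemma dual_normD (f g : dual) : dual_norm (f + g) <= dual_norm f + dual_norm g.
Proof.
apply: dual_norm_le => x x1.
by rewrite dualD (le_trans (ler_normD _ _))// lerD// dual_norm_ub.
Qed.

Lemma dual_normZ a (f : dual) : dual_norm (a *: f) = `|a| * dual_norm f.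
Proof.
have aux b (g : dual) : dual_norm (b *: g) <= `|b| * dual_norm g.
  apply: dual_norm_le => x x1.
  by rewrite dualZ normrM ler_wpM2l// dual_norm_ub.
apply/eqP; rewrite eq_le aux /=.
have [->|a0] := eqVneq a 0.
  rewrite normr0 mul0r (le_trans (normr_ge0 ((0 *: f) 0)))// dual_norm_ub//.
  by rewrite normr0.
rewrite -ler_pdivlMl ?normr_gt0// -normfV (le_trans _ (aux _ _))//.
by rewrite scalerA mulVf// scale1r.
Qed.

Lemma dual_norm_eq0 (f : dual) : dual_norm f = 0 -> f = 0.
Proof.
move=> f0; apply/val_inj/funext => x /=.
have f00 : f 0 = 0.
  have := dual_linear f 1 0 0.
  by rewrite scaler0 addr0 scale1r => /eqP; rewrite -subr_eq subrr => /eqP.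
have fZ a y : f (a *: y) = a * f y.
  by have := dual_linear f a y 0; rewrite f00 !addr0.
have [->|x0] := eqVneq x 0; first exact: f00.
have x1 : `| `|x|^-1 *: x| <= 1.
  by rewrite normrZ normfV normr_id mulVf// normr_eq0.
have := dual_norm_ub f x1; rewrite f0 normr_le0 fZ mulf_eq0 invr_eq0 normr_eq0 (negbTE x0)/=.
by move/eqP.
Qed.

HB.instance Definition _ := @Lmodule_isNormed.Build R dual
  dual_norm dual_normD dual_normZ dual_norm_eq0.

End dual_space.

Section L1_space.
Context d (T : measurableType d) (R : realType).
Variable mu : {measure set T -> \bar R}.

(* The library defines [LspaceType1 mu] only as a type of classes of functions;
   this section makes it a normed module. *)
Local Notation L1 := (LspaceType1 mu).
Local Notation Lfun1 := (LfunType mu (@lexx _ _ 1%E)).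
Local Open Scope quotient_scope.

Lemma ae_eq_Lnorm1 (f g : {mfun T >-> R}) : f = g %[ae mu] ->
  ('N[mu]_1[EFin \o f] = 'N[mu]_1[EFin \o g])%E.
Proof.
move=> fg; rewrite !Lnorm1; apply: ge0_ae_eq_integral => //.
- by apply: measurableT_comp => //; exact: measurableT_comp.
- by apply: measurableT_comp => //; exact: measurableT_comp.
- by apply: filterS fg => x /= fgx _; rewrite fgx.
Qed.

(* The library builds [LspaceType] from functions into [measurableTypeR R], and
   [LfunType] from functions into [R]: the sigma-algebras are the same but the
   displays differ. *)
Let mcast (f : {mfun T >-> R}) : {mfun T >-> measurableTypeR R} :=
  HB.pack (f : T -> measurableTypeR R)
    (isMeasurableFun.Build _ _ T (measurableTypeR R) (f : T -> measurableTypeR R)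
      (measurable_funPT f)).

Let quot := {mfun_ mu, T >-> measurableTypeR R}.

Let repr_pi_ae (f : {mfun T >-> measurableTypeR R}) :
  (repr (\pi_quot f) : T -> R) = f %[ae mu].
Proof.
have : ae_eq_op mu (repr (\pi_quot f)) f by apply/eqmodP; rewrite reprK.
by move/asboolP.
Qed.

Let L1_fun_mfun (f : quot) : measurable_fun setT (repr f : T -> R).
Proof. by move=> mT Y mY; exact: (@measurable_funPT _ _ _ _ (repr f)). Qed.

Let L1_funP (f : L1) : (repr (LebesgueSpace.sort f) : T -> R) \in Lfun mu 1.
Proof.
apply/andP; split; first by rewrite inE; exact: L1_fun_mfun.
by rewrite inE; exact: (@isFinLebesgue.Lebesgue_finite _ _ _ _ _ _ _
  (LebesgueSpace.class f)).
Qed.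

Definition L1_fun (f : L1) : Lfun1 := Lfun_Sub (@lexx _ _ 1%E) (L1_funP f).

Let L1_classP (f : Lfun1) :
  finite_norm mu 1 (aqEqMfun_to_fun (\pi_quot (mcast f))).
Proof.
rewrite /finite_norm.
have <- : ('N[mu]_1[EFin \o f])%E =
    ('N[mu]_1[EFin \o (repr (\pi_quot (mcast f)) : T -> R)])%E.
  have mg := L1_fun_mfun (\pi_quot (mcast f)).
  pose g : {mfun T >-> R} := HB.pack (repr (\pi_quot (mcast f)) : T -> R)
    (isMeasurableFun.Build _ _ T R _ mg).
  apply/esym/(@ae_eq_Lnorm1 g f); exact: (repr_pi_ae (mcast f)).
exact: Lfunction_finite.
Qed.

Definition L1_class (f : Lfun1) : L1 :=
  LebesgueSpace.Pack (LebesgueSpace.Class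
    (isFinLebesgue.Build d T R mu 1%E (@lexx _ _ 1%E) _ (L1_classP f))).

Lemma L1_classK (f : Lfun1) : L1_fun (L1_class f) = f %[ae mu].
Proof. exact: (repr_pi_ae (mcast f)). Qed.

Lemma L1_fun_inj (f g : L1) : L1_fun f = L1_fun g %[ae mu] -> f = g.
Proof.
move: f g => [f [[ff]]] [g [[fg]]] /= fg_ae.
have fgE : f = g.
  have /ae_eqP/eqP : aqEqMfun_to_fun f = g %[ae mu] by [].
  by rewrite !reprK.
by subst g; rewrite (Prop_irrelevance ff fg).
Qed.

Lemma L1_funK : cancel L1_fun L1_class.
Proof. by move=> f; apply: L1_fun_inj; exact: L1_classK. Qed.

Lemma L1_classE (f g : Lfun1) : f = g %[ae mu] -> L1_class f = L1_class g.
Proof.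
move=> fg; apply: L1_fun_inj.
apply: (ae_eq_trans (L1_classK f)); apply: (ae_eq_trans fg).
exact/ae_eq_sym/L1_classK.
Qed.

Definition L1_norm (f : L1) : R := fine 'N[mu]_1[EFin \o L1_fun f].

Definition L1_add (f g : L1) := L1_class (L1_fun f + L1_fun g).
Definition L1_opp (f : L1) := L1_class (- L1_fun f).
Definition L1_scale a (f : L1) := L1_class (a *: L1_fun f).

Lemma L1_classD f g : L1_add (L1_class f) (L1_class g) = L1_class (f + g).
Proof.
apply: L1_classE; have := L1_classK f; have := L1_classK g.
apply: filterS2 => x gx fx _.
change (L1_fun (L1_class f) x + L1_fun (L1_class g) x = f x + g x).
by rewrite gx// fx.
Qed.

Lemma L1_classZ a f : L1_scale a (L1_class f) = L1_class (a *: f).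
Proof.
apply: L1_classE; have := L1_classK f.
apply: filterS => x fx _.
change (a * L1_fun (L1_class f) x = a * f x).
by rewrite fx.
Qed.

Lemma L1_classN f : L1_opp (L1_class f) = L1_class (- f).
Proof.
apply: L1_classE; have := L1_classK f.
apply: filterS => x fx _.
change (- L1_fun (L1_class f) x = - f x).
by rewrite fx.
Qed.

Lemma L1_norm_class f : L1_norm (L1_class f) = fine 'N[mu]_1[EFin \o f].
Proof. by congr fine; apply: ae_eq_Lnorm1; exact: L1_classK. Qed.


Let L1_addA : associative L1_add.
Proof.
move=> f g h; rewrite -[f]L1_funK -[g]L1_funK -[h]L1_funK.
by rewrite !L1_classD addrA.
Qed.

Let L1_addC : commutative L1_add.
Proof.
by move=> f g; rewrite -[f]L1_funK -[g]L1_funK !L1_classD addrC.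
Qed.

Let L1_add0 : left_id (L1_class 0) L1_add.
Proof. by move=> f; rewrite -[f]L1_funK L1_classD add0r. Qed.

Let L1_addN : left_inverse (L1_class 0) L1_opp L1_add.
Proof. by move=> f; rewrite -[f]L1_funK L1_classN L1_classD addNr. Qed.

HB.instance Definition _ := gen_eqMixin L1.
HB.instance Definition _ := gen_choiceMixin L1.
HB.instance Definition _ := GRing.isZmodule.Build L1
  L1_addA L1_addC L1_add0 L1_addN.

Let L1_scaleA a b f : L1_scale a (L1_scale b f) = L1_scale (a * b) f.
Proof. by rewrite -[f]L1_funK !L1_classZ scalerA. Qed.

Let L1_scale1 : left_id 1 L1_scale.
Proof. by move=> f; rewrite -[f]L1_funK L1_classZ scale1r. Qed.

Let L1_scaleDr : right_distributive L1_scale +%R.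
Proof.
move=> a f g; rewrite -[f]L1_funK -[g]L1_funK.
by rewrite [LHS](congr1 (L1_scale a) (L1_classD _ _)) !L1_classZ
  [RHS]L1_classD scalerDr.
Qed.

Let L1_scaleDl f : {morph L1_scale^~ f : a b / a + b >-> a + b}.
Proof.
move=> a b; rewrite -[f]L1_funK !L1_classZ.
by rewrite [RHS]L1_classD scalerDl.
Qed.

HB.instance Definition _ := GRing.Zmodule_isLmodule.Build R L1
  L1_scaleA L1_scale1 L1_scaleDr L1_scaleDl.

Let L1_normD (f g : L1) : L1_norm (f + g) <= L1_norm f + L1_norm g.
Proof.
rewrite -[f]L1_funK -[g]L1_funK [X in L1_norm X]L1_classD !L1_norm_class.
exact: ler_LnormD.
Qed.

Let L1_normZ a (f : L1) : L1_norm (a *: f) = `|a| * L1_norm f.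
Proof.
rewrite -[f]L1_funK [X in L1_norm X]L1_classZ !L1_norm_class.
apply: EFin_inj; rewrite EFinM !finite_norm_fine.
exact: LnormZ.
Qed.

Let L1_norm_eq0 (f : L1) : L1_norm f = 0 -> f = 0.
Proof.
rewrite -[f]L1_funK L1_norm_class => /fine_Lnormr_eq0 f0.
exact: L1_classE.
Qed.

HB.instance Definition _ := @Lmodule_isNormed.Build R L1
  L1_norm L1_normD L1_normZ L1_norm_eq0.

End L1_space.

Lemma L1_normE (d : measure_display) (T : measurableType d) (R : realType)
    (mu : {measure set T -> \bar R}) (f : LspaceType1 mu) :
  `|f|%:E = (\int[mu]_x `|(L1_fun f x)%:E|)%E.
Proof. by rewrite -Lnorm1 -finite_norm_fine. Qed.

Definition linearly_isometric (R : realType) (V W : normedModType R) :=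
  exists J : {linear V -> W}, bijective J /\ forall v, `|J v| = `|v|.

Definition L1_predual (R : realType) (X : normedModType R) :=
  exists (d : measure_display) (T : measurableType d)
         (mu : {measure set T -> \bar R}),
    linearly_isometric (dual X) (LspaceType1 mu).

(* For a constant map on a trivial space the set is empty, and [sup set0 = 0]. *)
Definition lipschitz_norm (R : realType) (V W : normedModType R)
    (g : V -> W) : R :=
  sup [set `|g z.1 - g z.2| / `|z.1 - z.2| | z in [set z : V * V | z.1 != z.2]].

(* Main.v *)
(* Say that balls with centers c_i and radii r_i intersect pairwise when
   |c_i - c_j| <= r_i + r_j. The property that any four pairwise intersecting balls
   have, for every e > 0, a common point after enlarging the radii by e only involves
   distances, so it passes from X to Y through almost isometric bi-Lipschitz
   bijections. By Hahn-Banach it is equivalent to the following property of the dual: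
   if f_1 + f_2 + f_3 + f_4 = 0, then f_i = sum_j g_ij with g_ij = - g_ji and
   |f_i| = sum_j |g_ij|. An L1 space has this property, by an explicit formula.

   Conversely, let E be a complete space with the decomposition property, and C a
   maximal convex cone of E on which the norm is additive. Four vectors decompose as
   in Riesz' lemma inside C, and three vectors suffice to see that E = C - C with
   |p - n| = |p| + |n|; so E is a lattice with an additive norm on its positive cone.
   A maximal set S of compatible elements of C (they agree wherever neither of them
   vanishes, like indicator functions times a fixed weight) is a Boolean ring that
   spans E. The norm is a finitely additive measure on S, which becomes countably
   additive on the compact open subsets of the Stone space of S; linear combinations
   of elements of S have the same norm as the corresponding combinations of indicator
   functions, so E is isometric to the L1 space of this measure. *)
Require Import Defs.
From HB Require Import structures.
From mathcomp Require Import all_boot all_order all_algebra.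
From mathcomp Require Import all_classical all_reals all_analysis.
From mathcomp Require Import measurable_realfun ring lra.

Set Implicit Arguments.
Unset Strict Implicit.
Unset Printing Implicit Defensive.

Import Order.TTheory GRing.Theory Num.Theory.
Import numFieldNormedType.Exports HBSimple.

Local Open Scope classical_set_scope.
Local Open Scope ring_scope.

(** The norm of an L1 space does not determine its order: changing signs on a measurable set is an
    isometry. The positive cone therefore has to be chosen, and every maximal norm-additive cone
    turns out to generate the space. Similarly, without sigma-finiteness there need not be a
    strictly positive element, so [S] is a ring without unit.

    Four is the number of vectors in Riesz' lemma [a + b = c + d]. The balls meet only up to [e],
    which absorbs the distortion of the maps, yet the dual property is exact, because Hahn-Banach
    yields exact functionals. Both passages between balls and functionals are linear programming
    duality: the value of an optimization problem is a sublinear function of its data, and a linear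
    functional below it supplies the multipliers.

    The factor 2 in the definition of compatibility works because [min(2a, b) <= a] forces [b <= a]
    wherever [a > 0]. Countable additivity comes from compactness: a compact open set that is a
    countable disjoint union of compact open sets is a finite union of them. *)

(** * Identities between linear combinations, by reflection *)

Section lmodule_identities.
Context {R : realType} {V : lmodType R}.

Inductive lin_expr :=
  | LVar of nat | LZero | LAdd of lin_expr & lin_expr
  | LOpp of lin_expr | LScale of R & lin_expr.

Fixpoint lin_eval (env : seq V) (e : lin_expr) : V :=
  match e with
  | LVar n => nth 0 env n
  | LZero => 0
  | LAdd e1 e2 => lin_eval env e1 + lin_eval env e2
  | LOpp e1 => - lin_eval env e1
  | LScale c e1 => c *: lin_eval env e1
  end.

Fixpoint lin_coef (i : nat) (e : lin_expr) : R :=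
  match e with
  | LVar n => if Nat.eqb n i then 1 else 0
  | LZero => 0
  | LAdd e1 e2 => lin_coef i e1 + lin_coef i e2
  | LOpp e1 => - lin_coef i e1
  | LScale c e1 => c * lin_coef i e1
  end.

Lemma lin_evalE env e :
  lin_eval env e = \sum_(i < size env) lin_coef i e *: nth 0 env i.
Proof.
elim: e => [n||e1 IH1 e2 IH2|e IH|c e IH] /=.
- case: (ltnP n (size env)) => nsz; last first.
    rewrite nth_default// big1// => i _.
    have -> : Nat.eqb n i = false; last by rewrite scale0r.
    by apply/PeanoNat.Nat.eqb_neq => ni; move: nsz; rewrite ni leqNgt ltn_ord.
  rewrite (bigD1 (Ordinal nsz))//= PeanoNat.Nat.eqb_refl scale1r big1 ?addr0//.
  move=> i /eqP ni; have -> : Nat.eqb n i = false; last by rewrite scale0r.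
  by apply/PeanoNat.Nat.eqb_neq => ni'; apply: ni; apply/val_inj.
- by rewrite big1// => i _; rewrite scale0r.
- by rewrite IH1 IH2 -big_split; apply: eq_bigr => i _; rewrite scalerDl.
- by rewrite IH -sumrN; apply: eq_bigr => i _; rewrite scaleNr.
- by rewrite IH scaler_sumr; apply: eq_bigr => i _; rewrite scalerA.
Qed.

Fixpoint coef_eq (n : nat) (e1 e2 : lin_expr) : Prop :=
  match n with
  | 0 => True
  | S m => lin_coef m e1 = lin_coef m e2 /\ coef_eq m e1 e2
  end.

Lemma lin_eval_eq env e1 e2 :
  coef_eq (size env) e1 e2 -> lin_eval env e1 = lin_eval env e2.
Proof.
rewrite !lin_evalE => e12; apply: eq_bigr => i _; congr (_ *: _).
elim: (size env) e12 (i : nat) (ltn_ord i) => // n IH /= [en e12] j.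
by rewrite ltnS leq_eqVlt => /predU1P[->//|]; exact: IH.
Qed.

End lmodule_identities.

Ltac lin_index x env :=
  match env with
  | x :: _ => constr:(O)
  | _ :: ?t => let n := lin_index x t in constr:(S n)
  end.

Ltac lin_atoms env t :=
  match t with
  | 0%R => env
  | (?a + ?b)%R => let env1 := lin_atoms env a in lin_atoms env1 b
  | (- ?a)%R => lin_atoms env a
  | (_ *: ?a)%R => lin_atoms env a
  | _ => match env with
         | _ => let _ := lin_index t env in env
         | _ => constr:(t :: env)
         end
  end.

Ltac lin_reify R env t :=
  match t with
  | 0%R => constr:(@LZero R)
  | (?a + ?b)%R => let ea := lin_reify R env a in
                   let eb := lin_reify R env b in
                   constr:(@LAdd R ea eb)
  | (- ?a)%R => let ea := lin_reify R env a in constr:(@LOpp R ea)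
  | (?c *: ?a)%R => let ea := lin_reify R env a in constr:(@LScale R c ea)
  | _ => let n := lin_index t env in constr:(@LVar R n)
  end.

(* Proves identities between linear combinations in a module by comparing the
   coefficients of each atom with the tactic given as argument. *)
Ltac lmodule_eq_by tac :=
  lazymatch goal with
  | |- @eq ?T ?a ?b =>
    let env0 := lin_atoms (@nil T) a in
    let env := lin_atoms env0 b in
    let H := constr:(@lin_eval_eq _ _ env) in
    lazymatch type of H with
    | forall _ : @lin_expr ?R, _ =>
      let ea := lin_reify R env a in
      let eb := lin_reify R env b in
      refine (H ea eb _);
      cbn [coef_eq size lin_coef Nat.eqb]; repeat split; tac
    end
  end.
Ltac lmodule_eq := lmodule_eq_by ltac:(ring).

(** * The Hahn-Banach theorem *)

Definition sublinear (R : realType) (V : lmodType R) (p : V -> R) :=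
  (forall x y, p (x + y) <= p x + p y) /\
  (forall t x, 0 < t -> p (t *: x) = t * p x).

(** For the infima below only this inequality is checked: applied to [t^-1] and [t *: x] it gives
    its converse. *)
Lemma homogeneous_of_le (R : realType) (V : lmodType R) (p : V -> R) :
  (forall t x, 0 < t -> p (t *: x) <= t * p x) ->
  forall t x, 0 < t -> p (t *: x) = t * p x.
Proof.
move=> le t x t0; apply/eqP; rewrite eq_le le//=.
have := le t^-1 (t *: x); rewrite invr_gt0 scalerA mulVf ?gt_eqF// scale1r => /(_ t0).
by rewrite ler_pdivlMl.
Qed.

Section hahn_banach.
Context {R : realType} {V : lmodType R}.
Implicit Types p q : V -> R.

Lemma sublinear0 p : sublinear p -> p 0 = 0.
Proof.
move=> [_ pZ]; have := pZ 2 0 ltac:(lra); rewrite scaler0; lra.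
Qed.

Lemma sublinear_opp p x : sublinear p -> - p (- x) <= p x.
Proof.
move=> sp; have := sp.1 x (- x); rewrite subrr sublinear0//; lra.
Qed.

Lemma sublinearZ p t x : sublinear p -> 0 <= t -> p (t *: x) = t * p x.
Proof.
move=> sp; rewrite le_eqVlt => /predU1P[<-|/sp.2//].
by rewrite scale0r mul0r sublinear0.
Qed.

(* A minimal sublinear functional equals all its tilts, hence is linear. *)
Definition sublinear_tilt p (v : V) : V -> R :=
  fun x => inf [set p (x + t *: v) - t * p v | t in [set t | 0 <= t]].

Lemma sublinear_tilt_has_inf p v x : sublinear p ->
  has_inf [set p (x + t *: v) - t * p v | t in [set t | 0 <= t]].
Proof.
move=> sp; split; first by exists (p (x + 0 *: v) - 0 * p v), 0 => //=.
exists (- p (- x)) => _ [t /= t0 <-].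
have := sp.1 (x + t *: v) (- x).
have -> : x + t *: v - x = t *: v by lmodule_eq.
rewrite (sublinearZ _ sp)//; lra.
Qed.

Lemma sublinear_tilt_le p v x t : sublinear p -> 0 <= t ->
  sublinear_tilt p v x <= p (x + t *: v) - t * p v.
Proof.
by move=> sp t0; apply: ge_inf; [exact: (sublinear_tilt_has_inf _ _ sp).2|exists t].
Qed.

Lemma sublinear_tilt_ge p v x M : sublinear p ->
  (forall t, 0 <= t -> M <= p (x + t *: v) - t * p v) -> M <= sublinear_tilt p v x.
Proof.
move=> sp h; apply: lb_le_inf; first exact: (sublinear_tilt_has_inf _ _ sp).1.
by move=> _ [t t0 <-]; exact: h.
Qed.

Lemma sublinear_tilt_le_id p v x : sublinear p -> sublinear_tilt p v x <= p x.
Proof.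
by move=> sp; have := sublinear_tilt_le v x sp (lexx 0); rewrite scale0r addr0 mul0r subr0.
Qed.

Lemma sublinear_tiltP p v : sublinear p -> sublinear (sublinear_tilt p v).
Proof.
move=> sp; split.
  move=> x y.
  rewrite -lerBlDr; apply: sublinear_tilt_ge => // t t0.
  rewrite lerBlDr -lerBlDl; apply: sublinear_tilt_ge => // s s0.
  rewrite lerBlDl (le_trans (sublinear_tilt_le v (x + y) sp (addr_ge0 s0 t0)))//.
  have := sp.1 (x + t *: v) (y + s *: v).
  have -> : x + t *: v + (y + s *: v) = x + y + (s + t) *: v by lmodule_eq.
  lra.
apply: homogeneous_of_le => t x t0.
rewrite -ler_pdivrMl//; apply: sublinear_tilt_ge => // s s0.
rewrite ler_pdivrMl// (le_trans (sublinear_tilt_le v _ sp (mulr_ge0 (ltW t0) s0)))//.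
by rewrite mulrBr mulrA -(sp.2 t (x + _))// scalerDr scalerA.
Qed.

(** Zorn's lemma for the reversed pointwise order. A chain is bounded by its pointwise infimum,
    which is finite because every sublinear [q] below [p] satisfies [- p (- x) <= q x]. *)
Lemma minimal_sublinear p : sublinear p -> exists q, [/\ sublinear q,
  (forall x, q x <= p x) &
  forall q', sublinear q' -> (forall x, q' x <= q x) -> forall x, q' x = q x].
Proof.
move=> sp.
pose T := {q : V -> R | sublinear q /\ forall x, q x <= p x}.
pose le (q1 q2 : T) := `[< forall x, sval q2 x <= sval q1 x >].
have [] := @Zorn T le.
- by move=> q; apply/asboolP => x.
- move=> q1 q2 q3 /asboolP h1 /asboolP h2; apply/asboolP => x.
  exact: le_trans (h2 x) (h1 x).
- move=> [q1 h1] [q2 h2] /asboolP /= h12 /asboolP /= h21.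
  have e : q1 = q2 by apply/funext => x; apply/eqP; rewrite eq_le h12 h21.
  by subst q2; rewrite (Prop_irrelevance h1 h2).
- move=> A totA.
  have [[q0 Aq0]|A0] := pselect (A !=set0); last first.
    have sp' : sublinear p /\ forall x, p x <= p x by split.
    by exists (exist _ p sp') => s As; case: A0; exists s.
  pose r x := inf [set sval q x | q in A].
  have hi x : has_inf [set sval q x | q in A].
    split; first by exists (sval q0 x), q0.
    exists (- p (- x)) => _ [[q [sq qp]] _ <-] /=.
    by have := sublinear_opp x sq; have := qp (- x); lra.
  have rle (q : T) x : A q -> r x <= sval q x.
    by move=> Aq; apply: ge_inf; [exact: (hi x).2|exists q].
  have rge x M : (forall q : T, A q -> M <= sval q x) -> M <= r x.
    move=> h; apply: lb_le_inf; first exact: (hi x).1.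
    by move=> _ [q Aq <-]; exact: h.
  have rp : sublinear r /\ forall x, r x <= p x.
    split; last by move=> x; apply: (le_trans (rle _ _ Aq0)); exact: (svalP q0).2.
    split.
      move=> x y; rewrite -lerBlDr; apply: (rge _ _) => q Aq.
      rewrite lerBlDr -lerBlDl; apply: (rge _ _) => q' Aq'; rewrite lerBlDl.
      (* Of two members of the chain, the pointwise smaller one serves for both summands. *)
      have [qq'|q'q] := totA _ _ Aq Aq'.
        move/asboolP in qq'; rewrite (le_trans (rle _ _ Aq'))//.
        by rewrite (le_trans ((svalP q').1.1 x y))// lerD2r.
      move/asboolP in q'q; rewrite (le_trans (rle _ _ Aq))//.
      by rewrite (le_trans ((svalP q).1.1 x y))// lerD2l.
    apply: homogeneous_of_le => t x t0.
    rewrite -ler_pdivrMl//; apply: (rge _ _) => q Aq.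
    by rewrite ler_pdivrMl// (le_trans (rle _ _ Aq))// (svalP q).1.2.
  by exists (exist _ r rp) => q Aq; apply/asboolP => x /=; exact: rle.
move=> [q [sq qp]] /= qmin; exists q; split=> // q' sq' q'q.
have h : sublinear q' /\ forall x, q' x <= p x.
  by split=> // x; exact: le_trans (q'q x) (qp x).
by have /(_ _)/(congr1 sval)/= -> := qmin (exist _ q' h); last exact/asboolP.
Qed.

(** [F] is minimal below the tilt of [p] along [v], whose value at [- v] is at most [- p v]; this
    pushes [F v] up to [p v]. Additivity: by minimality [F] equals its own tilt along [y], which at
    [x] is at most [F (x + y) - F y]. *)
Lemma hahn_banach p v : sublinear p -> exists F : V -> R,
  [/\ forall a x y, F (a *: x + y) = a * F x + F y,
      forall x, F x <= p x & F v = p v].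
Proof.
move=> sp.
have [F [sF Fp Fmin]] := minimal_sublinear (sublinear_tiltP v sp).
have FD x y : F (x + y) = F x + F y.
  apply/eqP; rewrite eq_le sF.1/=.
  have e := Fmin _ (sublinear_tiltP y sF) (fun x => sublinear_tilt_le_id y x sF) x.
  have := sublinear_tilt_le y x sF ler01; rewrite e scale1r; lra.
have F0 := sublinear0 sF.
have FN x : F (- x) = - F x.
  by apply/eqP; rewrite -subr_eq0 opprK -FD addNr F0.
have FZ a x : F (a *: x) = a * F x.
  have [a0|a0] := leP 0 a; first by rewrite (sublinearZ _ sF).
  have := sublinearZ x sF (ltW (_ : 0 < - a)); rewrite oppr_gt0 => /(_ a0).
  by rewrite scaleNr FN mulNr => /oppr_inj.
exists F; split=> [a x y|x|].
- by rewrite FD FZ.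
- exact: le_trans (Fp x) (sublinear_tilt_le_id v x sp).
apply/eqP; rewrite eq_le (le_trans (Fp v) (sublinear_tilt_le_id v v sp))/=.
have := Fp (- v); have := sublinear_tilt_le v (- v) sp ler01.
rewrite scale1r addNr (sublinear0 sp) FN; lra.
Qed.

End hahn_banach.

(** * Intersecting balls and the decomposition property of the dual *)

Section dual_functionals.
Context {R : realType} {X : normedModType R}.
Implicit Type f : dual X.

Lemma dual0 f : f 0 = 0.
Proof.
have := dual_linear f 1 0 0; rewrite scaler0 addr0 scale1r => /eqP.
by rewrite -subr_eq subrr => /eqP.
Qed.

Lemma dual_mulr f a x : f (a *: x) = a * f x.
Proof. by have := dual_linear f a x 0; rewrite dual0 !addr0. Qed.

Lemma dual_addr f x y : f (x + y) = f x + f y.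
Proof. by have := dual_linear f 1 x y; rewrite !scale1r. Qed.

Lemma dual_oppr f x : f (- x) = - f x.
Proof. by rewrite -scaleN1r dual_mulr mulN1r. Qed.

Lemma dual_subr f x y : f (x - y) = f x - f y.
Proof. by rewrite dual_addr dual_oppr. Qed.

Lemma dual_norm_bound f x : `|f x| <= `|f| * `|x|.
Proof.
have [->|x0] := eqVneq x 0; first by rewrite dual0 !normr0 mulr0.
have x0' : 0 < `|x| by rewrite normr_gt0.
have : `|f (`|x|^-1 *: x)| <= `|f|.
  by apply: dual_norm_ub; rewrite normrZ normfV normr_id mulVf// gt_eqF.
by rewrite dual_mulr normrM normfV normr_id ler_pdivrMl// mulrC.
Qed.

Lemma dual_le_norm f x : f x <= `|f| * `|x|.
Proof. exact: le_trans (ler_norm _) (dual_norm_bound f x). Qed.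

Lemma sum_dualE (I : Type) (s : seq I) (P : pred I) (f : I -> dual X) x :
  (\sum_(i <- s | P i) f i) x = \sum_(i <- s | P i) f i x.
Proof. by elim/big_ind2 : _ => // f1 a1 f2 a2 <- <-. Qed.

Lemma bounded_linear_dual (f : X -> R) (M : R) :
  (forall a x y, f (a *: x + y) = a * f x + f y) ->
  (forall x, `|f x| <= M * `|x|) -> exists phi : dual X, forall x, phi x = f x.
Proof.
move=> lf bf.
pose F : {linear X -> R^o} := HB.pack (f : X -> R^o) (GRing.isLinear.Build _ _ _ _ _ lf).
have fP : (f : X -> R^o) \in @continuous_functional R X.
  rewrite inE; split=> //.
  apply/(linear_bounded_continuous F)/linear_boundedP; near=> r => x.
  by rewrite (le_trans (bf x))// ler_wpM2r//; near: r; exact: nbhs_pinfty_ge.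
by exists (Dual fP).
Unshelve. all: by end_near. Qed.

Lemma dual_norm_approx f e : 0 < e ->
  exists x, `|x| <= 1 /\ `|f| - e <= f x.
Proof.
move=> e0; have [_ [x /= x1 <-]] := sup_adherent e0 (dual_norm_has_sup f).
move=> /ltW fx; have [fx0|fx0] := leP 0 (f x).
  by exists x; split=> //; rewrite -(ger0_norm fx0).
by exists (- x); rewrite normrN dual_oppr -(ltr0_norm fx0).
Qed.

Lemma dual_sum_norm_le n (f : 'I_n -> dual X) (M : R) :
  (forall z : 'I_n -> X, (forall i, `|z i| <= 1) -> \sum_i f i (z i) <= M) ->
  \sum_i `|f i| <= M.
Proof.
move=> h; apply/ler_addgt0Pr => e e0.
(* The divisor is [n.+1], so that [n = 0] needs no separate case. *)
have e'0 : 0 < e / n.+1%:R by rewrite divr_gt0.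
have /choice[z zP] : forall i, exists x, `|x| <= 1 /\ `|f i| - e / n.+1%:R <= f i x.
  by move=> i; exact: dual_norm_approx.
have := h z (fun i => (zP i).1).
have : \sum_i (`|f i| - e / n.+1%:R) <= \sum_i f i (z i).
  by apply: ler_sum => i _; exact: (zP i).2.
rewrite sumrB sumr_const card_ord -[_ *+ n]mulr_natr.
have : e / n.+1%:R * n%:R <= e.
  by rewrite mulrAC ler_pdivrMr// ler_wpM2l ?ler_nat// ltW.
move: (e / _) (\sum_i _ ) (\sum_i _) => k a b; lra.
Qed.

End dual_functionals.

(** No sign condition on the radii: the case [i = j] of the hypothesis gives [0 <= r i]. *)
Definition almost_intersecting_balls (R : realType) (X : normedModType R) n :=
  forall (c : 'I_n -> X) (r : 'I_n -> R),
    (forall i j, `|c i - c j| <= r i + r j) ->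
    forall e, 0 < e -> exists x, forall i, `|x - c i| <= r i + e.

(* The property of the dual that is equivalent to [almost_intersecting_balls]. *)
Definition norm_decomposition (R : realType) (E : normedModType R) n :=
  forall f : 'I_n -> E, \sum_i f i = 0 -> exists g : 'I_n -> 'I_n -> E,
    [/\ forall i j, g i j = - g j i, forall i, f i = \sum_j g i j
      & forall i, \sum_j `|g i j| <= `|f i|].

Section balls_of_decomposition.
Context {R : realType} {X : normedModType R} {n : nat}.
Local Notation V := ('I_n.+1 -> R^o * X)%type.

Let radii (v : V) := [set m | exists x, forall i, `|(v i).2 - x| + (v i).1 <= m].

Let radii_has_inf v : has_inf (radii v).
Proof.
split.
  exists (\sum_j (`|(v j).2| + `|(v j).1|)), 0 => i; rewrite subr0.
  rewrite (bigD1 i)//= (le_trans (_ : _ <= `|(v i).2| + `|(v i).1|))//.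
    by rewrite lerD2l ler_norm.
  by rewrite lerDl sumr_ge0// => j _; rewrite addr_ge0.
exists (v ord0).1 => m [x /(_ ord0)].
have := normr_ge0 ((v ord0).2 - x); lra.
Qed.

(* [q (a, z)] is the infimum over [x] of [max_i (|z_i - x| + a_i)], so the balls
   [B(c_i, r_i)] almost intersect exactly when [q (- r, c) <= 0]. *)
Let q (v : V) := inf (radii v).

Let q_le v x m : (forall i, `|(v i).2 - x| + (v i).1 <= m) -> q v <= m.
Proof. by move=> h; apply: ge_inf; [exact: (radii_has_inf v).2|exists x]. Qed.

Let q_ge v M : (forall x m, (forall i, `|(v i).2 - x| + (v i).1 <= m) -> M <= m) -> M <= q v.
Proof.
move=> h; apply: lb_le_inf; first exact: (radii_has_inf v).1.
by move=> m [x xm]; exact: h xm.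
Qed.

Let q_sublinear : sublinear q.
Proof.
split.
  move=> u v; rewrite -lerBlDr; apply: q_ge => x m xm.
  rewrite lerBlDr -lerBlDl; apply: q_ge => y k yk; rewrite lerBlDl.
  apply: (q_le (x := x + y)) => i /=.
  have := ler_normD ((u i).2 - x) ((v i).2 - y).
  have -> : (u i).2 - x + ((v i).2 - y) = (u i).2 + (v i).2 - (x + y) by lmodule_eq.
  by have := xm i; have := yk i; lra.
apply: homogeneous_of_le => t v t0; rewrite -ler_pdivrMl//; apply: q_ge => x m xm.
rewrite ler_pdivrMl//; apply: (q_le (x := t *: x)) => i /=.
rewrite -scalerBr normrZ gtr0_norm// -[t *: (v i).1]/(t * (v i).1) -mulrDr.
by rewrite ler_pM2l.
Qed.

(** Let a linear [F <= q] attain [q] at [v0 = (- r, c)]. Its components are weights [lam i >= 0] and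
    functionals [f i] of norm at most [lam i], with sum 0 because [q] is at most 0 on constant
    families [(0, z)]. So [q v0] is the sum of the [f_i(c_i) - lam_i r_i], and decomposing [f_i]
    into the [g_ij] bounds twice the sum of the [f_i(c_i)] by the sum of the
    [|g_ij| |c_i - c_j|]. *)
Lemma balls_of_decomposition :
  norm_decomposition (dual X) n.+1 -> almost_intersecting_balls X n.+1.
Proof.
move=> decX c r cr e e0.
pose v0 : V := fun i => (- r i, c i).
have [F [lF Fq Fv0]] := hahn_banach v0 q_sublinear.
suff : q v0 <= 0.
  move=> q0; have [m [x xm] mq] : exists2 m, radii v0 m & m < q v0 + e.
    exact: inf_adherent.
  by exists x => i; rewrite distrC; have /= := xm i; lra.
have FD u v : F (u + v) = F u + F v by have := lF 1 u v; rewrite scale1r mul1r.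
have F0 : F 0 = 0 by have := FD 0 0; rewrite addr0; lra.
have FN u : F (- u) = - F u by have := FD u (- u); rewrite subrr F0; lra.
have Fsum (s : seq 'I_n.+1) (u : 'I_n.+1 -> V) :
    F (\sum_(i <- s) u i) = \sum_(i <- s) F (u i).
  by elim: s => [|i s IH]; rewrite ?big_nil// !big_cons FD IH.
pose single i (w : R^o * X) : V := fun j => if j == i then w else 0.
have singleD i w z : single i (w + z) = single i w + single i z.
  by apply/funext => j; rewrite /single/= !fctE; case: eqP => // _; rewrite addr0.
have singleZ i a w : single i (a *: w) = a *: single i w.
  by apply/funext => j; rewrite /single/= !fctE; case: eqP => // _; rewrite scaler0.
have sum_single (v : V) : v = \sum_i single i (v i).
  apply/funext => j; rewrite fct_sumE (bigD1 j)//= /single eqxx big1 ?addr0// => i ij.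
  by rewrite eq_sym (negbTE ij).
pose lam i := F (single i (1, 0)).
pose f i z := F (single i (0, z)).
have lf i a x y : f i (a *: x + y) = a * f i x + f i y.
  rewrite /f -lF -singleZ -singleD; congr (F (single i _)).
  by apply: injective_projections; rewrite //= scaler0 addr0.
have lam0 i : 0 <= lam i.
  rewrite -oppr_le0 -FN -scaleN1r -singleZ (le_trans (Fq _))//.
  apply: (q_le (x := 0)) => j; rewrite /single; case: eqP => _ /=.
    by rewrite scaler0 subr0 normr0 add0r -[_ *: _]/(-1 * 1); lra.
  by rewrite subr0 normr0 addr0.
have fle i z : f i z <= lam i * `|z|.
  have : F (single i (- `|z|, z)) <= 0.
    rewrite (le_trans (Fq _))//; apply: (q_le (x := 0)) => j; rewrite /single.
    by case: eqP => _ /=; rewrite subr0 ?subrr// normr0 addr0.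
  have -> : (- `|z|, z) = (- `|z| *: (1, 0) + (0, z) : R^o * X).
    apply: injective_projections; rewrite /= ?scaler0 ?add0r//.
    by rewrite -[_ *: _]/(- `|z| * 1) mulr1 addr0.
  by rewrite singleD singleZ lF /f /lam; lra.
have fN i z : f i (- z) = - f i z.
  have fi0 : f i 0 = 0 by have := lf i 1 0 0; rewrite scaler0 addr0; lra.
  by have := lf i (-1) z 0; rewrite addr0 fi0 scaleN1r; lra.
have fbound i z : `|f i z| <= lam i * `|z|.
  by rewrite ler_norml fle andbT lerNl -fN (le_trans (fle _ _))// normrN.
have /choice[phi phiE] : forall i, exists phi : dual X, forall x, phi x = f i x.
  by move=> i; apply: bounded_linear_dual (lf i) (fbound i).
have phi_norm i : `|phi i| <= lam i.
  apply: dual_norm_le => x x1; rewrite phiE (le_trans (fbound i x))//.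
  by rewrite ler_piMr.
have fsum z : \sum_i f i z <= 0.
  rewrite /f -Fsum (le_trans (Fq _))//; apply: (q_le (x := z)) => i.
  rewrite fct_sumE (bigD1 i)//= /single eqxx big1 ?addr0/= ?subrr ?normr0// => j ij.
  by rewrite eq_sym (negbTE ij).
have phi0 : \sum_i phi i = 0.
  apply/val_inj/funext => z /=; rewrite sum_dualE.
  under eq_bigr do rewrite phiE.
  apply/eqP; rewrite eq_le fsum/= -oppr_le0 -sumrN.
  by under eq_bigr do rewrite -fN; exact: fsum.
have [g [gA gE gN]] := decX phi phi0.
rewrite -Fv0 (sum_single v0) Fsum.
have -> : \sum_i F (single i (v0 i)) = \sum_i (phi i (c i) - lam i * r i).
  apply: eq_bigr => i _; rewrite phiE /f /lam.
  have -> : v0 i = (- r i *: (1, 0) + (0, c i) : R^o * X).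
    apply: injective_projections; rewrite /= ?scaler0 ?add0r//.
    by rewrite -[_ *: _]/(- r i * 1) mulr1 addr0.
  by rewrite singleD singleZ lF; lra.
rewrite sumrB subr_le0.
have r0 i : 0 <= r i by have := cr i i; rewrite subrr normr0; lra.
apply: (@le_trans _ _ (\sum_i `|phi i| * r i)); last first.
  by apply: ler_sum => i _; rewrite ler_wpM2r.
apply: (@le_trans _ _ (\sum_i \sum_j `|g i j| * r i)); last first.
  by apply: ler_sum => i _; rewrite -mulr_suml ler_wpM2r.
have -> : \sum_i phi i (c i) = \sum_i \sum_j g i j (c i).
  by apply: eq_bigr => i _; rewrite gE sum_dualE.
have gS i j : `|g i j| = `|g j i| by rewrite gA normrN.
have gV i j : g i j (c j) = - g j i (c j) by rewrite gA.
have e1 : \sum_i \sum_j g i j (c j) = - \sum_i \sum_j g i j (c i).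
  rewrite exchange_big/= -sumrN; apply: eq_bigr => i _.
  by rewrite -sumrN; apply: eq_bigr => j _; rewrite gV.
have e2 : \sum_i \sum_j `|g i j| * r j = \sum_i \sum_j `|g i j| * r i.
  rewrite exchange_big/=; apply: eq_bigr => i _; apply: eq_bigr => j _.
  by rewrite gS.
suff : \sum_i \sum_j g i j (c i) - \sum_i \sum_j g i j (c j) <=
    \sum_i \sum_j `|g i j| * r i + \sum_i \sum_j `|g i j| * r j by lra.
rewrite -sumrB -big_split/=; apply: ler_sum => i _.
rewrite -sumrB -big_split/=; apply: ler_sum => j _.
rewrite -dual_subr -mulrDr (le_trans (dual_le_norm _ _))//.
by rewrite ler_wpM2l.
Qed.

End balls_of_decomposition.

Section decomposition_of_balls.
Context {R : realType} {Y : normedModType R} {n : nat}.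
Local Notation W := ('I_n -> 'I_n -> Y).
Variable f : 'I_n -> dual Y.
Hypothesis f0 : \sum_i f i = 0.
Hypothesis balls : almost_intersecting_balls Y n.

(** Constraints of an optimization problem perturbed by [w]: for [w = 0] they say that the balls
    with centers [y i] and radii [s i] intersect pairwise. Only the antisymmetric part of [w]
    enters. *)
Let feasible (w : W) (s : 'I_n -> R) (y : 'I_n -> Y) :=
  forall i j, `|2^-1 *: (w i j - w j i) + (y i - y j)| <= s i + s j.

Let cost (s : 'I_n -> R) (y : 'I_n -> Y) := \sum_i `|f i| * s i - \sum_i f i (y i).

Let costs (w : W) := [set m | exists s y, feasible w s y /\ m = cost s y].

(** Boundedness below is where the balls enter: radii enlarged by [C] absorb [w], and an almost
    common point [y0] can be subtracted from all centers since the [f i] sum to 0. *)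
Let costs_has_inf w : has_inf (costs w).
Proof.
pose C := \sum_i \sum_j `|w i j|.
have wC i j : `|w i j| <= C.
  rewrite /C (bigD1 i)//= (bigD1 j)//= -addrA lerDl addr_ge0//.
    by rewrite sumr_ge0.
  by rewrite sumr_ge0// => k _; rewrite sumr_ge0.
have wB i j : `|2^-1 *: (w i j - w j i)| <= C.
  rewrite normrZ ger0_norm ?invr_ge0//.
  by have := ler_normB (w i j) (w j i); have := wC i j; have := wC j i; lra.
have C0 : 0 <= C by apply: sumr_ge0 => i _; apply: sumr_ge0.
split.
  exists (cost (fun=> C) (fun=> 0)), (fun=> C), (fun=> 0); split=> // i j.
  by rewrite subr0 addr0 (le_trans (wB i j))//; lra.
exists (- \sum_i `|f i| * (C + 1)) => _ [s [y [sy ->]]].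
have [|y0 y0P] := balls (c := y) (r := fun i => s i + C) _ ltr01.
  move=> i j; have := sy i j; have := wB i j.
  have := ler_normB (2^-1 *: (w i j - w j i) + (y i - y j)) (2^-1 *: (w i j - w j i)).
  have -> : 2^-1 *: (w i j - w j i) + (y i - y j) - 2^-1 *: (w i j - w j i) = y i - y j.
    by lmodule_eq.
  lra.
have : \sum_i f i (y i) <= \sum_i `|f i| * (s i + C + 1).
  have -> : \sum_i f i (y i) = \sum_i f i (y i - y0).
    under [RHS]eq_bigr do rewrite dual_subr.
    by rewrite sumrB -[X in _ - X]sum_dualE f0 subr0.
  apply: ler_sum => i _; rewrite (le_trans (dual_le_norm _ _))//.
  by rewrite ler_wpM2l// distrC y0P.
have -> : \sum_i `|f i| * (s i + C + 1) = \sum_i `|f i| * s i + \sum_i `|f i| * (C + 1).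
  by rewrite -big_split; apply: eq_bigr => i _; rewrite /=; ring.
rewrite /cost; lra.
Qed.

(* A linear functional below [p] restricts to [sum_i f_i(y_i)] on the arrays
   [w i j = y i - y j]; its components are the [g i j] of the decomposition. *)
Let p (w : W) := inf (costs w).

Let p_le w s y : feasible w s y -> p w <= cost s y.
Proof. by move=> sy; apply: ge_inf; [exact: (costs_has_inf w).2|exists s, y]. Qed.

Let p_ge w M : (forall s y, feasible w s y -> M <= cost s y) -> M <= p w.
Proof.
move=> h; apply: lb_le_inf; first exact: (costs_has_inf w).1.
by move=> _ [s [y [sy ->]]]; exact: h.
Qed.

Let p_sublinear : sublinear p.
Proof.
split.
  move=> u v; rewrite -lerBlDr; apply: p_ge => s y sy.
  rewrite lerBlDr -lerBlDl; apply: p_ge => t z tz; rewrite lerBlDl.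
  apply: (le_trans (p_le (s := s \+ t) (y := y \+ z) _)).
    move=> i j /=.
    have := ler_normD (2^-1 *: (u i j - u j i) + (y i - y j))
      (2^-1 *: (v i j - v j i) + (z i - z j)).
    have -> : 2^-1 *: (u i j - u j i) + (y i - y j) + (2^-1 *: (v i j - v j i) +
      (z i - z j)) = 2^-1 *: (u i j + v i j - (u j i + v j i)) +
      (y i + z i - (y j + z j)) by lmodule_eq.
    by have := sy i j; have := tz i j; rewrite !fctE; lra.
  rewrite /cost.
  under eq_bigr do rewrite /= mulrDr.
  under [X in _ - X <= _]eq_bigr do rewrite /= dual_addr.
  rewrite !big_split/=; lra.
apply: homogeneous_of_le => t v t0; rewrite -ler_pdivrMl//; apply: p_ge => s y sy.
rewrite ler_pdivrMl//.
apply: (le_trans (p_le (s := fun i => t * s i) (y := fun i => t *: y i) _)).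
  move=> i j; rewrite -mulrDr.
  have -> : 2^-1 *: ((t *: v) i j - (t *: v) j i) + (t *: y i - t *: y j) =
    t *: (2^-1 *: (v i j - v j i) + (y i - y j)) by rewrite !fctE; lmodule_eq.
  by rewrite normrZ gtr0_norm// ler_pM2l.
rewrite /cost.
under eq_bigr do rewrite mulrCA.
under [X in _ - X <= _]eq_bigr do rewrite dual_mulr.
by rewrite -!mulr_sumr mulrBr.
Qed.

(** A linear [F <= p] is tested on two kinds of arrays. For differences [y a - y b], zero radii and
    centers [- y] are feasible, which determines [F] there. For [star i z], radius [m] at [i] and 0
    elsewhere is feasible, which bounds the sum over [j] of the [g_ij(z_j)] by [|f_i| m], hence that
    of the [|g_ij|] by [|f_i|]. *)
Lemma decomposition_of_balls_aux : exists g : 'I_n -> 'I_n -> dual Y,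
  [/\ forall i j, g i j = - g j i, forall i, f i = \sum_j g i j
    & forall i, \sum_j `|g i j| <= `|f i|].
Proof.
have [F [lF Fp _]] := hahn_banach 0 p_sublinear.
have FD u v : F (u + v) = F u + F v by have := lF 1 u v; rewrite scale1r mul1r.
have F0 : F 0 = 0 by have := FD 0 0; rewrite addr0; lra.
have FN u : F (- u) = - F u by have := FD u (- u); rewrite subrr F0; lra.
have Fsum (s : seq 'I_n) (u : 'I_n -> W) :
    F (\sum_(i <- s) u i) = \sum_(i <- s) F (u i).
  by elim: s => [|i s IH]; rewrite ?big_nil// !big_cons FD IH.
(* Row [i] is [z] and column [i] is [- z]; at [(i, i)] the two cancel. *)
pose star i (z : 'I_n -> Y) : W := fun a b =>
  (if a == i then z b else 0) - (if b == i then z a else 0).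
have star_half i z a b : 2^-1 *: (star i z a b - star i z b a) = star i z a b.
  rewrite /star; set u := if _ then _ else _; set v := if _ then _ else _.
  by lmodule_eq_by ltac:(lra).
have Fdelta (y : 'I_n -> Y) : F (fun a b => y a - y b) = \sum_i f i (y i).
  have Fle (z : 'I_n -> Y) : F (fun a b => z a - z b) <= \sum_i f i (z i).
    apply: (le_trans (Fp _)).
    apply: (le_trans (p_le (s := fun=> 0) (y := fun i => - z i) _)).
      move=> i j; rewrite addr0.
      have -> : 2^-1 *: (z i - z j - (z j - z i)) + (- z i - - z j) = 0.
        by lmodule_eq_by ltac:(lra).
      by rewrite normr0.
    rewrite /cost big1 => [|i _]; last by rewrite mulr0.
    by under eq_bigr do rewrite dual_oppr; rewrite sumrN sub0r opprK.
  apply/eqP; rewrite eq_le Fle/=.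
  have := Fle (fun i => - y i).
  have -> : (fun a b => - y a - - y b) = - (fun a b => y a - y b) :> W.
    by apply/funext => a; apply/funext => b; rewrite !fctE; lmodule_eq.
  rewrite FN; under [X in _ <= X -> _]eq_bigr do rewrite dual_oppr.
  by rewrite sumrN lerN2.
have Fstar i z m : (forall j, `|z j| <= m) -> F (star i z) <= `|f i| * m.
  move=> zm; apply: (le_trans (Fp _)).
  pose s (a : 'I_n) := if a == i then m else 0.
  apply: (le_trans (p_le (s := s) (y := fun=> 0) _)).
    move=> a b; rewrite subr0 addr0 star_half (le_trans (ler_normB _ _))//.
    by rewrite /s lerD//; case: eqP; rewrite ?normr0.
  rewrite /cost [X in _ - X]big1 => [|j _]; last by rewrite dual0.
  rewrite subr0 (bigD1 i)//= /s eqxx big1 ?addr0// => j ji.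
  by rewrite (negbTE ji) mulr0.
pose single (b : 'I_n) (z : Y) : 'I_n -> Y := fun a => if a == b then z else 0.
pose G i j z := F (star i (single j z)).
have lG i j a x y : G i j (a *: x + y) = a * G i j x + G i j y.
  rewrite /G -lF; congr F; apply/funext => a'; apply/funext => b.
  rewrite !fctE /star /single.
  case: (a' =P i) => _; case: (b =P i) => _; case: (a' =P j) => _;
    case: (b =P j) => _; lmodule_eq.
have GN i j z : G i j (- z) = - G i j z.
  have Gi0 : G i j 0 = 0 by have := lG i j 1 0 0; rewrite scaler0 addr0; lra.
  by have := lG i j (-1) z 0; rewrite addr0 Gi0 scaleN1r; lra.
have Gle i j z : G i j z <= `|f i| * `|z|.
  by apply: Fstar => b; rewrite /single; case: eqP => _; rewrite ?normr0.
have Gbound i j z : `|G i j z| <= `|f i| * `|z|.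
  by rewrite ler_norml Gle andbT lerNl -GN (le_trans (Gle _ _ _))// normrN.
have /choice[g gE] : forall i, exists gi : 'I_n -> dual Y, forall j x, gi j x = G i j x.
  move=> i; have /choice[gi giE] : forall j, exists h : dual Y, forall x, h x = G i j x.
    by move=> j; apply: bounded_linear_dual (lG i j) (Gbound i j).
  by exists gi.
have star_sum i z : star i z = \sum_j star i (single j (z j)).
  have sumE (a : 'I_n) : \sum_j single j (z j) a = z a.
    rewrite (bigD1 a)//= /single eqxx big1 ?addr0// => k ka.
    by rewrite eq_sym (negbTE ka).
  apply/funext => a; apply/funext => b; rewrite !fct_sumE /star sumrB.
  by case: (a =P i) => _; case: (b =P i) => _; rewrite ?big1_eq ?sumE.
have gsum i z : \sum_j g i j (z j) = F (star i z).
  by rewrite star_sum Fsum; apply: eq_bigr => j _; rewrite gE.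
exists g; split=> [i j|i|i].
- apply/val_inj/funext => z; change (g i j z = - g j i z).
  rewrite !gE -FN; congr F; apply/funext => a; apply/funext => b.
  rewrite !fctE /star /single.
  case: (a =P i) => _; case: (b =P i) => _; case: (a =P j) => _;
    case: (b =P j) => _; lmodule_eq.
(* For a constant [z] the array [star i] consists of the differences of [single i z], on which [F]
   is known. *)
- apply/val_inj/funext => z /=; rewrite sum_dualE (gsum i (fun=> z)).
  transitivity (\sum_j f j (single i z j)).
    rewrite (bigD1 i)//= /single eqxx big1 ?addr0// => j ji.
    by rewrite (negbTE ji) dual0.
  by rewrite -Fdelta.
- apply: dual_sum_norm_le => z z1; rewrite gsum.
  by have := Fstar i z 1 z1; rewrite mulr1.
Qed.

End decomposition_of_balls.

Lemma decomposition_of_balls (R : realType) (Y : normedModType R) n :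
  almost_intersecting_balls Y n -> norm_decomposition (dual Y) n.
Proof. by move=> balls f f0; exact: decomposition_of_balls_aux. Qed.

(** * Transfer along almost isometric bi-Lipschitz maps *)

Section lipschitz_transfer.
Context {R : realType}.

Lemma lipschitz_norm_ge0 (V W : normedModType R) (g : V -> W) :
  lipschitz g -> 0 <= lipschitz_norm g.
Proof.
move=> lg; rewrite /lipschitz_norm; set A := (X in sup X).
have [A0|/set0P[a Aa]] := eqVneq A set0; first by rewrite A0 sup0.
have A_ge0 b : A b -> 0 <= b by move=> [z _ <-]; rewrite divr_ge0.
apply: (le_trans (A_ge0 _ Aa)); apply: ub_le_sup => //.
have /pinfty_ex_gt0[M _ gM] := lg; exists M => _ [[x y] /= xy <-].
by rewrite ler_pdivrMr ?normr_gt0 ?subr_eq0//; exact: (gM (x, y)).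
Qed.

Lemma lipschitz_norm_bound (V W : normedModType R) (g : V -> W) x y :
  lipschitz g -> `|g x - g y| <= lipschitz_norm g * `|x - y|.
Proof.
move=> lg; have [->|xy] := eqVneq x y; first by rewrite !subrr !normr0 mulr0.
rewrite -ler_pdivrMr ?normr_gt0 ?subr_eq0//; apply: ub_le_sup; last by exists (x, y).
have /pinfty_ex_gt0[M _ gM] := lg; exists M => _ [[u v] /= uv <-].
by rewrite ler_pdivrMr ?normr_gt0 ?subr_eq0//; exact: (gM (u, v)).
Qed.

(** Centers are pulled back by [psi], with radii multiplied by its constant, and the point found in
    [X] is pushed forward by [phi]. The finitely many radii are bounded by [M], so the factor
    [1 + e / 2 / M] enlarges each by at most [e / 2]. *)
Lemma almost_intersecting_balls_lipschitz (X Y : normedModType R) n :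
  (forall e : R, 0 < e -> exists (phi : X -> Y) (psi : Y -> X),
     [/\ cancel phi psi, cancel psi phi, lipschitz phi, lipschitz psi
       & lipschitz_norm phi * lipschitz_norm psi <= 1 + e]) ->
  almost_intersecting_balls X n -> almost_intersecting_balls Y n.
Proof.
move=> equiv ballsX c r cr e e0.
have r0 i : 0 <= r i by have := cr i i; rewrite subrr normr0; lra.
pose M := 1 + \sum_i r i.
have M1 : 1 <= M by rewrite lerDl sumr_ge0.
have rM i : r i <= M.
  rewrite /M (bigD1 i)//=.
  have : 0 <= \sum_(j < n | j != i) r j by rewrite sumr_ge0.
  by move: (\sum_(j < n | j != i) r j) => s s0; lra.
have eM0 : 0 < e / 2 / M by rewrite !divr_gt0//; lra.
have [phi [psi [phiK psiK lphi lpsi phipsi]]] := equiv _ eM0.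
set A := lipschitz_norm phi in phipsi *; set B := lipschitz_norm psi in phipsi *.
have A0 : 0 <= A by exact: lipschitz_norm_ge0.
have B0 : 0 <= B by exact: lipschitz_norm_ge0.
have A10 : 0 < A + 1 by lra.
(* The divisor is [A + 1] because [A] is 0 when [X] is trivial. *)
have [||x xP] := ballsX (psi \o c) (fun i => B * r i) _ (e / 2 / (A + 1)).
- move=> i j /=; rewrite (le_trans (lipschitz_norm_bound _ _ lpsi))//.
  by rewrite -mulrDr ler_wpM2l.
- by rewrite !divr_gt0//; lra.
exists (phi x) => i.
rewrite -(psiK (c i)) (le_trans (lipschitz_norm_bound _ _ lphi))//.
rewrite (le_trans (ler_wpM2l A0 (xP i)))// mulrDr mulrA.
have h1 : A * B * r i <= r i + e / 2.
  rewrite (le_trans (ler_wpM2r (r0 i) phipsi))// mulrDl mul1r lerD2l.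
  by rewrite mulrAC ler_pdivrMr ?ler_wpM2l//; lra.
have h2 : A * (e / 2 / (A + 1)) <= e / 2.
  by rewrite mulrCA ler_piMr//; [lra|rewrite ler_pdivrMr//; lra].
by move: h1 h2; rewrite -/A -/B; lra.
Qed.

End lipschitz_transfer.

(** * Completeness of the dual and invariance under isometries *)

(** Every Cauchy sequence has a subsequence of this kind, so this is completeness, expressed through
    the norm only, for use with [dual X] and [LspaceType1]. *)
Definition geometric_complete (R : realType) (V : normedModType R) :=
  forall u : nat -> V, (forall n, `|u n.+1 - u n| <= 2^-1 ^+ n) ->
  exists l, forall e, 0 < e -> exists N, forall n, (N <= n)%N -> `|u n - l| < e.

Lemma half_expr_lt (R : realType) (e : R) : 0 < e ->
  exists N, forall n, (N <= n)%N -> 2^-1 ^+ n < e.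
Proof.
move=> e0; exists (Num.bound e^-1) => n Nn.
rewrite exprVn invf_plt ?posrE ?exprn_gt0//.
have := @archi_boundP R e^-1; rewrite invr_ge0 => /(_ (ltW e0)) /lt_le_trans; apply.
by rewrite -natrX ler_nat (leq_trans Nn)// ltnW// ltn_expl.
Qed.

Lemma geometric_dist (R : realType) (V : normedModType R) (u : nat -> V) n m :
  (forall n, `|u n.+1 - u n| <= 2^-1 ^+ n) -> (n <= m)%N ->
  `|u m - u n| <= 2 * 2^-1 ^+ n.
Proof.
move=> uP /subnKC <-; move: (m - n)%N => {m}k; elim: k n => [|k IH] n.
  by rewrite addn0 subrr normr0 mulr_ge0// exprn_ge0// invr_ge0.
have := IH n.+1; rewrite addSnnS exprS => h.
have := ler_normD (u (n + k.+1)%N - u n.+1) (u n.+1 - u n).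
by rewrite subrKA; have := uP n; lra.
Qed.

(** The limit at [x] is the supremum of the lower bounds [u n x - d n |x|]. Each of them is below
    every upper bound [u m x + d m |x|], which yields [|u n x - l x| <= d n |x|] at once; linearity
    follows from this estimate. *)
Lemma dual_geometric_complete (R : realType) (X : normedModType R) :
  geometric_complete (dual X).
Proof.
move=> u uP.
pose d n : R := 2 * 2^-1 ^+ n.
have d0 n : 0 <= d n by rewrite mulr_ge0// exprn_ge0// invr_ge0.
have udist n m : `|u n - u m| <= d n + d m.
  have [nm|mn] := leqP n m.
    by rewrite distrC (le_trans (geometric_dist uP nm))// lerDl.
  by rewrite (le_trans (geometric_dist uP (ltnW mn)))// lerDr.
have uxdist x n m : u n x - d n * `|x| <= u m x + d m * `|x|.
  have := dual_le_norm (u n - u m) x; rewrite [X in X <= _](_ : _ = u n x - u m x)//.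
  have := ler_wpM2r (normr_ge0 x) (udist n m); lra.
pose l x := sup (range (fun n => u n x - d n * `|x|)).
have lE x n : `|u n x - l x| <= d n * `|x|.
  have hs : has_sup (range (fun n => u n x - d n * `|x|)).
    split; first by exists (u 0 x - d 0 * `|x|), 0.
    by exists (u 0 x + d 0 * `|x|) => _ [k _ <-].
  rewrite ler_norml; apply/andP; split.
    suff : l x <= u n x + d n * `|x| by lra.
    by apply: ge_sup; [exact: hs.1|move=> _ [k _ <-]].
  suff : u n x - d n * `|x| <= l x by lra.
  by apply: ub_le_sup; [exact: hs.2|exists n].
have small (a C : R) : (forall n, `|a| <= d n * C) -> a = 0.
  move=> h; apply/eqP; rewrite -normr_eq0 eq_le normr_ge0 andbT.
  have C0 : 0 <= C.
    have := le_trans (normr_ge0 a) (h 0); rewrite /d expr0; lra.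
  apply/ler_addgt0Pr => e e0; rewrite add0r.
  have [] := @half_expr_lt R (e / (2 * (C + 1))).
    by rewrite divr_gt0// mulr_gt0//; lra.
  move=> N /(_ _ (leqnn N)) /ltW NP; apply: (le_trans (h N)).
  have : d N * (C + 1) <= e.
    rewrite /d -mulrA [_ * (C + 1)]mulrC mulrA.
    have := NP; rewrite ler_pdivlMr ?mulr_gt0//; lra.
  have := d0 N; lra.
have llin a x y : l (a *: x + y) = a * l x + l y.
  apply/eqP; rewrite -subr_eq0; apply/eqP.
  apply: (small _ (`|a *: x + y| + (`|a| * `|x| + `|y|))) => n.
  have h1 := lE (a *: x + y) n; have h2 := lE x n; have h3 := lE y n.
  have -> : l (a *: x + y) - (a * l x + l y) =
     - (u n (a *: x + y) - l (a *: x + y)) + (a * (u n x - l x) + (u n y - l y)).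
    by rewrite dual_linear /GRing.scale/=; ring.
  rewrite (le_trans (ler_normD _ _))// normrN [leRHS]mulrDr lerD//.
  rewrite (le_trans (ler_normD _ _))// [leRHS]mulrDr lerD// normrM.
  by rewrite mulrCA ler_wpM2l.
have lbound x : `|l x| <= (`|u 0%N| + d 0) * `|x|.
  have := ler_normB (u 0 x) (u 0 x - l x); rewrite opprB addrC subrK.
  by have := lE x 0; have := dual_norm_bound (u 0) x; rewrite mulrDl; lra.
have [L LE] := bounded_linear_dual llin lbound.
exists L => e e0; have e20 : 0 < e / 2 by rewrite divr_gt0.
have [N NP] := half_expr_lt e20.
exists N => n Nn; apply: (@le_lt_trans _ _ (d n)); last first.
  by rewrite /d; have := NP _ Nn; lra.
apply: dual_norm_le => x x1; rewrite [X in `|X|](_ : _ = u n x - L x)// LE.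
by rewrite (le_trans (lE x n))// ler_piMr.
Qed.

Lemma norm_decomposition_isometry (R : realType) (E F : normedModType R) n :
  linearly_isometric E F -> norm_decomposition F n -> norm_decomposition E n.
Proof.
move=> [J [[K JK KJ] Jn]] decF f f0.
have Jinj : injective J by exact: can_inj JK.
have KN y : K (- y) = - K y by apply: Jinj; rewrite linearN !KJ.
have Kn y : `|K y| = `|y| by rewrite -Jn KJ.
have [|g [gA gE gN]] := decF (J \o f).
  by rewrite -linear_sum/= f0 linear0.
exists (fun i j => K (g i j)); split=> [i j|i|i].
- by rewrite gA KN.
- by apply: Jinj; rewrite linear_sum -[LHS]/((J \o f) i) gE; apply: eq_bigr => j _; rewrite KJ.
- by under eq_bigr do rewrite Kn; rewrite -Jn.
Qed.

(** * The space of integrable functions *)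

Lemma pos_neg_part_spec (R : realType) (a : R) :
  [\/ [/\ 0 <= a, Num.max a 0 = a, Num.max (- a) 0 = 0 & `|a| = a]
    | [/\ a < 0, Num.max a 0 = 0, Num.max (- a) 0 = - a & `|a| = - a]].
Proof.
have [a0|a0] := leP 0 a; [left|right]; split=> //.
- by rewrite max_r//; lra.
- exact: ger0_norm.
- by rewrite max_l//; lra.
- exact: ltr0_norm.
Qed.

Section L1_representatives.
Context d (T : measurableType d) (R : realType).
Variable mu : {measure set T -> \bar R}.
Local Notation L1 := (LspaceType1 mu).
Implicit Types (F G : L1) (f g : T -> R).

(** Classes are handled through representing functions: identities are checked almost everywhere and
    return to [L1] by [represents_unique]. *)
Definition represents F f := L1_fun F = f %[ae mu].

Lemma L1_fun_integrable F : mu.-integrable [set: T] (EFin \o L1_fun F).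
Proof. by apply/Lfun1_integrable; exact: LfunP. Qed.

Lemma L1_fun_measurable F : measurable_fun [set: T] (L1_fun F).
Proof. by have /measurable_int/measurable_EFinP := L1_fun_integrable F. Qed.

Lemma L1_fun_represents F : represents F (L1_fun F).
Proof. by apply: aeW => x. Qed.

Lemma represents_exists f : mu.-integrable [set: T] (EFin \o f) ->
  exists F, represents F f.
Proof.
move=> /Lfun1_integrable fL; exists (L1_class (Lfun_Sub (@lexx _ _ 1%E) fL)).
exact: L1_classK.
Qed.

Lemma represents_unique F G f : represents F f -> represents G f -> F = G.
Proof.
by move=> Ff Gf; apply: L1_fun_inj; apply: ae_eq_trans Ff (ae_eq_sym Gf).
Qed.

Lemma represents_ae F f g : represents F f -> f = g %[ae mu] -> represents F g.
Proof. exact: ae_eq_trans. Qed.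

Lemma representsD F G f g : represents F f -> represents G g ->
  represents (F + G) (f \+ g).
Proof.
move=> Ff Gg; have := L1_classK (L1_fun F + L1_fun G).
move: Ff Gg; rewrite /represents; apply: filterS3 => x fx gx fgx _.
by rewrite [LHS]fgx//= -fx// -gx.
Qed.

Lemma representsZ F f (a : R) : represents F f -> represents (a *: F) (fun x => a * f x).
Proof.
move=> Ff; have := L1_classK (a *: L1_fun F).
by move: Ff; rewrite /represents; apply: filterS2 => x fx afx _; rewrite [LHS]afx// -fx.
Qed.

Lemma representsN F f : represents F f -> represents (- F) (fun x => - f x).
Proof.
move=> /(representsZ (-1)); rewrite scaleN1r.
by under eq_fun do rewrite mulN1r.
Qed.

Lemma representsB F G f g : represents F f -> represents G g ->
  represents (F - G) (f \- g).
Proof. by move=> Ff Gg; exact: representsD Ff (representsN Gg). Qed.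

Lemma represents0 : represents 0 (fun=> 0).
Proof.
have := representsZ 0 (L1_fun_represents 0); rewrite scale0r.
by under eq_fun do rewrite mul0r.
Qed.

Lemma represents_sum (I : Type) (s : seq I) (F : I -> L1) (f : I -> T -> R) :
  (forall i, represents (F i) (f i)) ->
  represents (\sum_(i <- s) F i) (fun x => \sum_(i <- s) f i x).
Proof.
move=> Ff; elim: s => [|i s IH].
  rewrite big_nil; under eq_fun do rewrite big_nil; exact: represents0.
have -> : (fun x => \sum_(j <- i :: s) f j x) = f i \+ (fun x => \sum_(j <- s) f j x).
  by apply/funext => x; rewrite big_cons.
by rewrite big_cons; exact: representsD.
Qed.

Lemma represents_norm F f : measurable_fun [set: T] f -> represents F f ->
  `|F|%:E = (\int[mu]_x `|(f x)%:E|)%E.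
Proof.
move=> mf Ff; rewrite L1_normE; apply: ge0_ae_eq_integral => //.
- by apply: measurableT_comp => //; apply/measurable_EFinP; exact: L1_fun_measurable.
- by apply: measurableT_comp => //; apply/measurable_EFinP.
- by move: Ff; apply: filterS => x fx _; rewrite fx.
Qed.

Lemma L1_norm_sub F G : `|F - G|%:E = (\int[mu]_x `|(L1_fun F x - L1_fun G x)%:E|)%E.
Proof.
apply: (@represents_norm _ (L1_fun F \- L1_fun G)).
  by apply: measurable_funB; exact: L1_fun_measurable.
by apply: representsB; exact: L1_fun_represents.
Qed.

(** At each point the positive values are distributed proportionally over the negative ones: if [P]
    is the sum of the positive parts, equal to that of the negative parts, then
    [g_ij = (f_i^+ f_j^- - f_i^- f_j^+) / P]. Since [S = 2 P], this is [2 h / S], a formula that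
    stays bounded by [2 |f_i|] on the null set where the [f_i] do not add up to 0. *)
Lemma L1_norm_decomposition n : norm_decomposition L1 n.
Proof.
move=> F F0.
pose f i := L1_fun (F i); have mf i := L1_fun_measurable (F i).
pose S x := \sum_k `|f k x|.
have mS : measurable_fun setT S.
  by apply: measurable_sum => k; apply: measurableT_comp => //; exact: mf.
have S0 x : 0 <= S x by apply: sumr_ge0.
pose h i j x := (Num.max (f i x) 0 * Num.max (- f j x) 0
                 - Num.max (- f i x) 0 * Num.max (f j x) 0).
pose g i j x := 2 * h i j x * (S x)^-1.
have mg i j : measurable_fun setT (g i j).
  apply: measurable_funM; last first.
    have -> : (fun x => (S x)^-1) = (@powR R ^~ (-1)) \o S.
      by apply/funext => x /=; rewrite powR_inv1.
    by apply: measurableT_comp.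
  apply: measurable_funM => //; apply: measurable_funB; apply: measurable_funM;
    apply: measurable_maxr => //; try exact: mf; by apply: measurableT_comp => //; exact: mf.
have fS i x : `|f i x| <= S x by rewrite /S (bigD1 i)//= lerDl sumr_ge0.
have hle i j x : `|h i j x| <= `|f i x| * `|f j x|.
  rewrite /h; have [[fi -> -> ->]|[fi -> -> ->]] := pos_neg_part_spec (f i x);
    have [[fj -> -> ->]|[fj -> -> ->]] := pos_neg_part_spec (f j x);
    by rewrite ler_norml; apply/andP; split; nra.
have gle i j x : `|g i j x| <= 2 * `|f i x|.
  rewrite /g !normrM normfV (ger0_norm (S0 x)) -mulrA ger0_norm// ler_pM2l//.
  have [->|Sx] := eqVneq (S x) 0; first by rewrite invr0 mulr0.
  have Sx0 : 0 < S x by rewrite lt_def Sx S0.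
  by rewrite ler_pdivrMr// (le_trans (hle i j x))// ler_wpM2l.
have ig i j : mu.-integrable [set: T] (EFin \o g i j).
  apply: (@le_integrable _ _ _ _ _ _ _ (fun x => 2%:E * (EFin \o f i) x)%E) => //.
  - exact/measurable_EFinP.
  - move=> x _ /=; rewrite lee_fin (le_trans (gle i j x))// normrM ger0_norm//.
  - by apply: integrableZl => //; exact: L1_fun_integrable.
have /choice[G GP] : forall i, exists Gi : 'I_n -> L1, forall j, represents (Gi j) (g i j).
  move=> i; have /choice[Gi GiP] : forall j, exists Gij, represents Gij (g i j).
    by move=> j; exact: represents_exists.
  by exists Gi.
have sum0 : {ae mu, forall x, \sum_i f i x = 0}.
  have := represents_sum (index_enum 'I_n) (fun i => L1_fun_represents (F i)).
  rewrite F0 => F0f; have := represents0; move: F0f; rewrite /represents.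
  by apply: filterS2 => x -> // ->.
have key x : \sum_i f i x = 0 -> forall i, f i x = \sum_j g i j x /\
    \sum_j `|g i j x| = `|f i x|.
  move=> fx0 i.
  pose P := \sum_j Num.max (f j x) 0; pose N := \sum_j Num.max (- f j x) 0.
  have PN : P = N.
    apply/eqP; rewrite -subr_eq0 -sumrB -[X in _ == X]fx0; apply/eqP; apply: eq_bigr => j _.
    by have [[_ -> -> _]|[_ -> -> _]] := pos_neg_part_spec (f j x); lra.
  have SPN : S x = 2 * P.
    rewrite /S mulr_natl mulr2n {2}PN /P /N -big_split; apply: eq_bigr => j _ /=.
    by have [[_ -> -> ->]|[_ -> -> ->]] := pos_neg_part_spec (f j x); lra.
  have [Sx|Sx] := eqVneq (S x) 0.
    have fi0 : f i x = 0.
      by apply/eqP; rewrite -normr_le0 -Sx.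
    have g0 j : g i j x = 0 by rewrite /g Sx invr0 mulr0.
    by split; rewrite ?fi0 ?normr0 big1// => j _; rewrite g0 ?normr0.
  have SM : S x * (S x)^-1 = 1 by rewrite divff.
  split.
    rewrite -mulr_suml -mulr_sumr sumrB -!mulr_sumr -/P -/N -PN -mulrBl.
    have -> : Num.max (f i x) 0 - Num.max (- f i x) 0 = f i x.
      by have [[_ -> -> _]|[_ -> -> _]] := pos_neg_part_spec (f i x); lra.
    by rewrite mulrCA -SPN -mulrA SM mulr1.
  have habs j : `|g i j x| = 2 * (Num.max (f i x) 0 * Num.max (- f j x) 0
                 + Num.max (- f i x) 0 * Num.max (f j x) 0) * (S x)^-1.
    rewrite /g !normrM normfV (ger0_norm (S0 x)) ger0_norm//; congr (_ * _ * _).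
    rewrite /h; have [[fi -> -> _]|[fi -> -> _]] := pos_neg_part_spec (f i x);
      have [[fj -> -> _]|[fj -> -> _]] := pos_neg_part_spec (f j x);
      rewrite !(mul0r, mulr0, subr0, sub0r, addr0, add0r, normr0, normrN)//;
      by rewrite ger0_norm//; nra.
  under eq_bigr do rewrite habs.
  rewrite -mulr_suml -mulr_sumr big_split/= -!mulr_sumr -/P -/N -PN -mulrDl.
  have -> : Num.max (f i x) 0 + Num.max (- f i x) 0 = `|f i x|.
    by have [[_ -> -> ->]|[_ -> -> ->]] := pos_neg_part_spec (f i x); lra.
  by rewrite mulrCA -SPN -mulrA SM mulr1.
have Gsum i : represents (\sum_j G i j) (fun x => \sum_j g i j x).
  exact: represents_sum.
exists G; split=> [i j|i|i].
- apply: (represents_unique (GP i j)).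
  have := representsN (GP j i); congr represents; apply/funext => x.
  by rewrite /g /h; ring.
- apply: (represents_unique (L1_fun_represents _)); apply: represents_ae (Gsum i) _.
  by move: sum0; apply: filterS => x /key/(_ i)[-> _].
rewrite -lee_fin -sumEFin.
under eq_bigr do rewrite (represents_norm (mg _ _) (GP _ _)).
rewrite -ge0_integral_sum//; last first.
  by move=> j; apply: measurableT_comp => //; exact/measurable_EFinP.
rewrite L1_normE le_eqVlt; apply/orP; left; apply/eqP.
apply: ge0_ae_eq_integral => //.
- by apply: emeasurable_sum => j; apply: measurableT_comp => //; exact/measurable_EFinP.
- by apply: measurableT_comp => //; exact/measurable_EFinP.
- by move=> x _; apply: sume_ge0.
- move: sum0; apply: filterS => x /key/(_ i)[_ gf] _.
  by rewrite sumEFin gf.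
Qed.

(** Riesz-Fischer: the integrals of the increments add up to at most 2, so the sum [g] of the
    increments is integrable, hence finite almost everywhere, and [|f_0| + g] dominates the
    sequence. *)
Lemma L1_geometric_complete : geometric_complete L1.
Proof.
move=> u uP.
pose f n := L1_fun (u n); have mf n := L1_fun_measurable (u n).
pose D n x := `|f n.+1 x - f n x|.
have mD n : measurable_fun setT (EFin \o D n).
  apply/measurable_EFinP; apply: measurableT_comp => //.
  by apply: measurable_funB; exact: mf.
pose g x := (\sum_(0 <= n <oo) (D n x)%:E)%E.
have mg : measurable_fun setT g.
  apply: (@ge0_emeasurable_sum _ _ _ setT (fun n x => (D n x)%:E) xpredT) => [n x _ _|n _].
    by rewrite lee_fin normr_ge0.
  exact: mD.
have g0 x : (0 <= g x)%E.
  by apply: nneseries_ge0 => n _ _; rewrite lee_fin normr_ge0.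
have ig : mu.-integrable setT g.
  apply/integrableP; split => //.
  under eq_integral do rewrite gee0_abs//.
  rewrite integral_nneseries//; last by move=> n x _; rewrite lee_fin normr_ge0.
  apply: (@le_lt_trans _ _ 2%:E); last by rewrite ltry.
  apply: lime_le.
    by apply: is_cvg_nneseries => n _ _; apply: integral_ge0 => x _; rewrite lee_fin normr_ge0.
  near=> n; rewrite /=.
  have -> : (\sum_(0 <= k < n) \int[mu]_x (D k x)%:E = (\sum_(0 <= k < n) `|u k.+1 - u k|)%:E)%E.
    by rewrite -sumEFin; apply: eq_bigr => k _; rewrite L1_norm_sub.
  rewrite lee_fin (le_trans (ler_sum _ (fun k _ => uP k)))//.
  have -> : \sum_(0 <= k < n) 2^-1 ^+ k = 2 - 2 * 2^-1 ^+ n :> R.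
    elim: (n) => [|k IH]; first by rewrite big_nil expr0; lra.
    by rewrite big_nat_recr//= IH exprS; lra.
  by rewrite gerBl mulr_ge0// exprn_ge0// invr_ge0.
have gfin := integrable_ae measurableT ig.
have fcvg x : g x \is a fin_num -> cvgn (fun n => f n x).
  move=> gx.
  have : cvgn (series (fun n => f n.+1 x - f n x)).
    apply: normed_cvg; apply: nondecreasing_is_cvgn.
      by apply/nondecreasing_seqP => n /=; rewrite !seriesEnat/= big_nat_recr//= lerDl.
    exists (fine (g x)) => _ [n _ <-] /=; rewrite -lee_fin fineK// seriesEnat/= -sumEFin.
    by apply: nneseries_lim_ge => k _ _; rewrite lee_fin normr_ge0.
  move=> sc; have -> : (fun n => f n x) = (fun n => f 0%N x + series (fun n => f n.+1 x - f n x) n).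
    apply/funext => n; rewrite seriesEnat/= telescope_sumr//; lra.
  by apply: is_cvgD => //; exact: is_cvg_cst.
(* The limit superior is measurable without restriction to the set of convergence. *)
pose l x := fine (limn_esup (fun n => (f n x)%:E)).
have ml : measurable_fun setT (EFin \o l).
  apply/measurable_EFinP; apply: measurableT_comp => //.
  by apply: measurable_fun_limn_esup => n; apply/measurable_EFinP; exact: mf.
have lP x : g x \is a fin_num -> (fun n => (f n x)%:E) @ \oo --> (l x)%:E.
  move=> /fcvg fx; have fxE : (fun n => (f n x)%:E) @ \oo --> (lim ((fun n => f n x) @ \oo))%:E.
    by apply: cvg_EFin => //; near=> n.
  by rewrite /l (cvg_limn_einf_sup fxE).2.
have [] := @dominated_convergence _ _ _ mu setT measurableT (fun n x => (f n x)%:E)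
  (EFin \o l) (fun x => `|(f 0%N x)%:E| + g x)%E.
- by move=> n; apply/measurable_EFinP; exact: mf.
- exact: ml.
- by move: gfin; apply: filterS => x gx _; apply: lP; exact: gx.
- by apply: integrableD => //; apply: integrable_abse; exact: L1_fun_integrable.
- move: gfin; apply: filterS => x /(_ I) gx n _.
  rewrite -(fineK gx) abse_EFin -EFinD lee_fin.
  have : \sum_(0 <= k < n) D k x <= fine (g x).
    rewrite -lee_fin fineK// -sumEFin.
    by apply: nneseries_lim_ge => k _ _; rewrite lee_fin normr_ge0.
  have : `|f n x - f 0%N x| <= \sum_(0 <= k < n) D k x.
    by rewrite -(@telescope_sumr _ 0 n (fun k => f k x))//; exact: ler_norm_sum.
  have := ler_normD (f 0%N x) (f n x - f 0%N x); rewrite addrC subrK; lra.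
move=> il cvgl _.
have [L LP] := represents_exists il.
exists L => e e0.
have /fine_cvgP[_] := cvgl.
move=> /cvgrPdist_lt /(_ e e0)[N _ NP]; exists N => n Nn.
have := NP n Nn; rewrite /= sub0r normrN.
apply: le_lt_trans; rewrite ger0_norm ?fine_ge0 ?integral_ge0//.
have := @represents_norm (u n - L) (f n \- l).
rewrite le_eqVlt => H; apply/orP; left; apply/eqP.
rewrite -[LHS]/(fine `|u n - L|%:E) H//.
- by apply: measurable_funB; [exact: mf|exact/measurable_EFinP].
- by apply: representsB => //; exact: L1_fun_represents.
Unshelve. all: by end_near. Qed.

End L1_representatives.

(** * Maximal norm-additive cones *)

Section norm_parts.
Context {R : realType} {E : normedModType R}.
Implicit Types (a b f g x : E) (A : set E).

(* In an [L1] space, [part a f] means that [a = theta * f] with [0 <= theta <= 1]. *)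
Definition part a f := `|f| = `|a| + `|f - a|.

Definition approx_closed A :=
  forall l, (forall e, 0 < e -> exists a, A a /\ `|l - a| < e) -> A l.

Lemma partP a f : `|a| + `|f - a| <= `|f| -> part a f.
Proof.
move=> h; apply/eqP; rewrite eq_le h andbT.
by rewrite (le_trans _ (ler_normD _ _))// addrC subrK.
Qed.

Lemma part_refl a : part a a.
Proof. by rewrite /part subrr normr0 addr0. Qed.

Lemma part_trans b a f : part a b -> part b f -> part a f.
Proof.
rewrite /part => ab bf; apply: partP; have := ler_normD (f - b) (b - a).
have -> : f - b + (b - a) = f - a by lmodule_eq.
lra.
Qed.

Lemma part_sub a f : part a f -> part (f - a) f.
Proof.
rewrite /part; have -> : f - (f - a) = a by lmodule_eq.
by rewrite addrC.
Qed.

Lemma part_approx_closed_r a : approx_closed (part a).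
Proof.
move=> l h; apply: partP; apply/ler_addgt0Pr => e e0.
have [|f [af lf]] := h (e / 2); first by rewrite divr_gt0.
move: af; rewrite /part => af.
have := ler_normD (l - f) (f - a).
have -> : l - f + (f - a) = l - a by lmodule_eq.
have := ler_normD (f - l) l; rewrite subrK (distrC f l); lra.
Qed.

Lemma part_approx_closed_l g : approx_closed [set a | part a g].
Proof.
move=> l h; apply: partP; apply/ler_addgt0Pr => e e0.
have [|a [ag la]] := h (e / 2); first by rewrite divr_gt0.
move: ag; rewrite /= /part => ag.
have := ler_normD (g - a) (a - l); rewrite (distrC a l).
have -> : g - a + (a - l) = g - l by lmodule_eq.
have := ler_normD (l - a) a; rewrite subrK; lra.
Qed.

(** The norm of [a'] is within [e] of the supremum over those elements of [A] of which [a] is a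
    part; by transitivity any [b] of which [a'] is a part is among them. *)
Lemma maximal_part_step A a e : A a -> (exists M, forall b, A b -> `|b| <= M) ->
  0 < e -> exists a', [/\ A a', part a a' &
    forall b, A b -> part a' b -> `|b| <= `|a'| + e].
Proof.
move=> Aa [M bA] e0.
have hs : has_sup [set `|b| | b in [set b | A b /\ part a b]].
  split; first by exists `|a|, a => //; split=> //; exact: part_refl.
  by exists M => _ [b [Ab _] <-]; exact: bA.
have [_ [a' [Aa' aa'] <-] sa'] := sup_adherent e0 hs.
exists a'; split=> // b Ab a'b.
suff : `|b| <= sup [set `|b| | b in [set b | A b /\ part a b]] by lra.
by apply: ub_le_sup; [exact: hs.2|exists b => //; split=> //; exact: part_trans a'b].
Qed.

(* Along an increasing sequence whose norms are almost maximal, the norm is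
   additive, so the sequence is Cauchy and its limit is maximal. *)
Lemma maximal_part A a0 : geometric_complete E -> A a0 -> approx_closed A ->
  (exists M, forall a, A a -> `|a| <= M) ->
  exists a, [/\ A a, part a0 a & forall b, A b -> part a b -> b = a].
Proof.
move=> compE Aa0 clA bA.
have half0 n : (0 : R) < 2^-1 ^+ n by rewrite exprn_gt0// invr_gt0.
have /choice[nxt nxtP] : forall p : nat * E, exists a', A p.2 ->
    [/\ A a', part p.2 a' & forall b, A b -> part a' b -> `|b| <= `|a'| + 2^-1 ^+ p.1].
  move=> [n a]; have [Aa|nAa] := pselect (A a); last by exists a.
  by have [a' a'P] := maximal_part_step Aa bA (half0 n); exists a'.
pose u := fix u n := if n is m.+1 then nxt (m.+1, u m) else nxt (0%N, a0).
have uA n : A (u n).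
  by elim: n => [|n IH]; [have [] := nxtP (0%N, a0) Aa0|have [] := nxtP (n.+1, u n) IH].
have umax n b : A b -> part (u n) b -> `|b| <= `|u n| + 2^-1 ^+ n.
  case: n => [|n]; first by have [_ _] := nxtP (0%N, a0) Aa0; apply.
  by have [_ _] := nxtP (n.+1, u n) (uA n); apply.
have ustep n : part (u n) (u n.+1) by have [] := nxtP (n.+1, u n) (uA n).
have upart n m : (n <= m)%N -> part (u n) (u m).
  move=> /subnKC <-; elim: (m - n)%N => [|k IH]; first by rewrite addn0; exact: part_refl.
  by rewrite addnS; exact: part_trans IH (ustep _).
have ugeom n : `|u n.+1 - u n| <= 2^-1 ^+ n.
  by have := umax n _ (uA n.+1) (ustep n); have := ustep n; rewrite /part; lra.
have [l lP] := compE u ugeom.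
have lim e : 0 < e -> forall n, exists2 m, (n <= m)%N & `|l - u m| < e.
  move=> e0 n; have [N NP] := lP e e0; exists (maxn n N); first exact: leq_maxl.
  by rewrite distrC NP// leq_maxr.
have Al : A l by apply: clA => e /lim /(_ 0%N)[m _ um]; exists (u m).
have ul n : part (u n) l.
  by apply: part_approx_closed_r => e /lim /(_ n)[m nm um]; exists (u m); split=> //; exact: upart.
exists l; split=> //.
  by apply: part_trans (ul 0%N); have [] := nxtP (0%N, a0) Aa0.
move=> b Ab lb; apply/eqP; rewrite -subr_eq0 -normr_eq0 eq_le normr_ge0 andbT.
apply/ler_addgt0Pr => e e0; rewrite add0r.
have [N /(_ _ (leqnn N)) NP] := half_expr_lt e0.
have := umax N _ Ab (part_trans (ul N) lb); have := ul N.
by move: lb; rewrite /part; have := normr_ge0 (l - u N); lra.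
Qed.

End norm_parts.

Section maximal_cone.
Context {R : realType} {E : normedModType R}.
Implicit Types (a b c f g x : E) (C : set E).

Definition norm_additive_cone C :=
  [/\ forall a b, C a -> C b -> C (a + b),
      forall t a, 0 < t -> C a -> C (t *: a)
    & forall a b, C a -> C b -> `|a + b| = `|a| + `|b|].

Definition maximal_additive_cone C :=
  norm_additive_cone C /\ forall D, C `<` D -> ~ norm_additive_cone D.

Lemma maximal_additive_cone_exists : exists C, maximal_additive_cone C.
Proof.
apply: Zorn_bigcup => F FP totF; split.
- move=> a b [X FX Xa] [Y FY Yb]; have [XY|YX] := totF _ _ FX FY.
    by exists Y => //; have [+ _ _] := FP _ FY; apply => //; exact: XY.
  by exists X => //; have [+ _ _] := FP _ FX; apply => //; exact: YX.
- by move=> t a t0 [X FX Xa]; exists X => //; have [_ + _] := FP _ FX; apply.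
- move=> a b [X FX Xa] [Y FY Yb]; have [XY|YX] := totF _ _ FX FY.
    by have [_ _] := FP _ FY; apply => //; exact: XY.
  by have [_ _] := FP _ FX; apply => //; exact: YX.
Qed.

Variable C : set E.
Hypothesis maxC : maximal_additive_cone C.

Lemma maximal_cone_norm a b : C a -> C b -> `|a + b| = `|a| + `|b|.
Proof. by have [[_ _ +] _] := maxC; exact. Qed.

Lemma maximal_cone_add a b : C a -> C b -> C (a + b).
Proof. by have [[+ _ _] _] := maxC; exact. Qed.

(** The cone generated by [C] and [x] is again norm-additive, since
    [c + t *: x = t *: (t^-1 *: c + x)] reduces its norms to the hypothesis; maximality then puts
    [x] in [C]. *)
Lemma maximal_cone_adjoin x : (forall c, C c -> `|c + x| = `|c| + `|x|) -> C x.
Proof.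
move=> xP; have [[CD CZ CN] Cmax] := maxC.
pose D := [set y | exists c t, [/\ C c \/ c = 0, 0 <= t & y = c + t *: x]].
have CD0 a b : C a \/ a = 0 -> C b \/ b = 0 -> C (a + b) \/ a + b = 0.
  move=> [Ca|->] [Cb|->]; rewrite ?add0r ?addr0; [|by left|by left|by right].
  by left; exact: CD.
have CN0 a b : C a \/ a = 0 -> C b \/ b = 0 -> `|a + b| = `|a| + `|b|.
  by move=> [Ca|->] [Cb|->]; rewrite ?add0r ?addr0 ?normr0 ?add0r ?addr0//; exact: CN.
have Dnorm c t : C c \/ c = 0 -> 0 <= t -> `|c + t *: x| = `|c| + t * `|x|.
  move=> [Cc|->]; last by rewrite !add0r normr0 add0r normrZ => /ger0_norm ->.
  rewrite le_eqVlt => /predU1P[<-|t0]; first by rewrite scale0r mul0r !addr0.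
  have -> : c + t *: x = t *: (t^-1 *: c + x).
    by lmodule_eq_by ltac:(by field; rewrite gt_eqF).
  rewrite normrZ xP; last by apply: CZ => //; rewrite invr_gt0.
  rewrite normrZ !gtr0_norm ?invr_gt0// mulrDr mulrA divff ?mul1r// gt_eqF//.
have Dcone : norm_additive_cone D.
  split.
  - move=> _ _ [a [s [Ca s0 ->]]] [b [t [Cb t0 ->]]].
    exists (a + b), (s + t); split; [exact: CD0|exact: addr_ge0|by lmodule_eq].
  - move=> t _ t0 [a [s [Ca s0 ->]]]; exists (t *: a), (t * s); split.
    + by case: Ca => [Ca|->]; [left; exact: CZ|right; rewrite scaler0].
    + by rewrite mulr_ge0// ltW.
    + by lmodule_eq.
  - move=> _ _ [a [s [Ca s0 ->]]] [b [t [Cb t0 ->]]].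
    have -> : a + s *: x + (b + t *: x) = a + b + (s + t) *: x by lmodule_eq.
    rewrite !Dnorm ?addr_ge0//; last exact: CD0.
    by rewrite CN0// mulrDl; lra.
have CsubD : C `<=` D.
  by move=> c Cc; exists c, 0; split=> //; [left|rewrite scale0r addr0].
apply: contrapT => nCx; apply: (Cmax D) => //; split=> // /(_ x).
by apply: contra_not nCx; apply; exists 0, 1; split; [right|lra|rewrite scale1r add0r].
Qed.

Lemma maximal_cone0 : C 0.
Proof. by apply: maximal_cone_adjoin => c _; rewrite normr0 !addr0. Qed.

Lemma maximal_coneZ t a : 0 <= t -> C a -> C (t *: a).
Proof.
rewrite le_eqVlt => /predU1P[<- _|t0]; first by rewrite scale0r; exact: maximal_cone0.
by have [[_ + _] _] := maxC; apply.
Qed.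

Lemma maximal_cone_approx_closed : approx_closed C.
Proof.
move=> x h; apply: maximal_cone_adjoin => c Cc; apply/eqP; rewrite eq_le ler_normD/=.
apply/ler_addgt0Pr => e e0.
have [|a [Ca xa]] := h (e / 2); first by rewrite divr_gt0.
have := maximal_cone_norm Cc Ca; have := ler_normD (c + x) (a - x).
have -> : c + x + (a - x) = c + a by lmodule_eq.
have := ler_normD (x - a) a; rewrite subrK (distrC a x); lra.
Qed.

(** Since [b + c = (b + a) + (c - a)] and [|c - a| = |c| - |a|], the triangle inequality gives
    [|b| + |a| <= |b + a|] for [b] in [C]. *)
Lemma maximal_cone_part a c : C c -> part a c -> C a.
Proof.
rewrite /part => Cc ac; apply: maximal_cone_adjoin => b Cb.
apply/eqP; rewrite eq_le ler_normD/=.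
have := ler_normD (b + a) (c - a); have := maximal_cone_norm Cb Cc.
have -> : b + a + (c - a) = b + c by lmodule_eq.
lra.
Qed.

Lemma maximal_cone_pointed a : C a -> C (- a) -> a = 0.
Proof.
move=> Ca Cna; apply/eqP; rewrite -normr_eq0.
have := maximal_cone_norm Ca Cna; rewrite subrr normr0 normrN => e.
by apply/eqP; have := normr_ge0 a; lra.
Qed.

Hypothesis compE : geometric_complete E.
Hypothesis decE : norm_decomposition E 4.

(* The decomposition property applied to [f], [g], [- (f + g)] and [0]. *)
Lemma decomposition3 f g : exists w, [/\ part w f, part (- w) g
  & `|f + g| = `|f - w| + `|g + w|].
Proof.
pose F (i : 'I_4) : E := nth 0 [:: f; g; - (f + g); 0] i.
have [|G [GA GE GN]] := decE (f := F).
  by rewrite !big_ord_recl big_ord0 /F/=; lmodule_eq.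
have G0 i : G i i = 0.
  have /eqP := GA i i; rewrite -addr_eq0 -mulr2n -scaler_nat scaler_eq0 pnatr_eq0/=.
  by move/eqP.
pose i0 : 'I_4 := ord0; pose i1 : 'I_4 := lift ord0 ord0.
pose i2 : 'I_4 := lift ord0 (lift ord0 ord0).
pose i3 : 'I_4 := lift ord0 (lift ord0 (lift ord0 ord0)).
have sum4 (V : nmodType) (h : 'I_4 -> V) : \sum_i h i = h i0 + (h i1 + (h i2 + (h i3 + 0))).
  by rewrite !big_ord_recl big_ord0.
(* The norm bound kills the row of the fourth vector 0, leaving a decomposition of three vectors. *)
have Gi3 j : G i3 j = 0.
  apply/eqP; rewrite -normr_le0; have := GN i3.
  have -> : F i3 = 0 by []. rewrite normr0; apply: le_trans.
  by rewrite (bigD1 j)//= lerDl sumr_ge0.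
have Gj3 j : G j i3 = 0 by rewrite GA Gi3 oppr0.
have := GE i0; have := GE i1; have := GE i2.
have := GN i0; have := GN i1; have := GN i2.
rewrite !sum4 !G0 !Gj3 !normr0 !add0r !addr0.
rewrite (GA i1 i0) (GA i2 i0) (GA i2 i1) !normrN.
have -> : F i0 = f by []. have -> : F i1 = g by []. have -> : F i2 = - (f + g) by [].
move: (G i0 i1) (G i0 i2) (G i1 i2) => w p q; rewrite ?normrN.
move=> n2 n1 n0 e2 e1 e0; exists w.
have fw : f - w = p by rewrite e0; lmodule_eq.
have gw : g + w = q by rewrite e1; lmodule_eq.
split; first by apply: partP; rewrite fw.
  by apply: partP; rewrite opprK gw normrN.
apply/eqP; rewrite fw gw eq_le n2 andbT -fw -gw.
have -> : f + g = f - w + (g + w) by lmodule_eq.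
exact: ler_normD.
Qed.

(* The decomposition property applied to [a], [b], [- c] and [- d]: the component
   common to [a] and [- b] lies in both [C] and [- C], hence vanishes. *)
Lemma riesz_decomposition a b c d : C a -> C b -> C c -> C d -> a + b = c + d ->
  exists p q r s, [/\ C p, C q, C r & C s] /\
    [/\ a = p + q, b = r + s, c = p + r & d = q + s].
Proof.
move=> Ca Cb Cc Cd abcd.
pose F (i : 'I_4) : E := nth 0 [:: a; b; - c; - d] i.
have [|G [GA GE GN]] := decE (f := F).
  rewrite !big_ord_recl big_ord0 /F/=.
  have -> : a + (b + (- c + (- d + 0))) = a + b - (c + d) by lmodule_eq.
  by rewrite abcd subrr.
have G0 i : G i i = 0.
  have /eqP := GA i i; rewrite -addr_eq0 -mulr2n -scaler_nat scaler_eq0 pnatr_eq0/=.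
  by move/eqP.
pose i0 : 'I_4 := ord0; pose i1 : 'I_4 := lift ord0 ord0.
pose i2 : 'I_4 := lift ord0 (lift ord0 ord0).
pose i3 : 'I_4 := lift ord0 (lift ord0 (lift ord0 ord0)).
have Gpart i j : part (G i j) (F i).
  apply: partP; apply: le_trans (GN i); rewrite (bigD1 j)//= lerD2l.
  rewrite {1}GE (bigD1 j)//= addrAC subrr add0r; exact: ler_norm_sum.
have sum4 (h : 'I_4 -> E) : \sum_i h i = h i0 + (h i1 + (h i2 + (h i3 + 0))).
  by rewrite !big_ord_recl big_ord0.
have Cpos i j : C (F i) -> C (G i j) by move=> /maximal_cone_part; apply; exact: Gpart.
have partN x y : part x (- y) -> part (- x) y.
  rewrite /part !normrN opprK -(normrN (- y - x)).
  by have -> : - (- y - x) = y + x by lmodule_eq.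
have C01 : G i0 i1 = 0.
  apply: maximal_cone_pointed; first exact: (Cpos i0 i1 Ca).
  by rewrite -GA; exact: (Cpos i1 i0 Cb).
have C23 : G i2 i3 = 0.
  apply: maximal_cone_pointed; last first.
    by apply: (maximal_cone_part Cc); apply: partN; exact: Gpart.
  by rewrite GA; apply: (maximal_cone_part Cd); apply: partN; exact: Gpart.
have := GE i0; have := GE i1; have := GE i2; have := GE i3.
rewrite !sum4 !G0 (GA i1 i0) (GA i3 i2) (GA i2 i0) (GA i3 i0) (GA i2 i1) (GA i3 i1).
rewrite C01 C23 !oppr0 !add0r !addr0.
have -> : F i0 = a by []. have -> : F i1 = b by []. have -> : F i2 = - c by [].
have -> : F i3 = - d by [].
move=> e3 e2 e1 e0.
exists (G i0 i2), (G i0 i3), (G i1 i2), (G i1 i3); split.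
  split.
  - exact: (Cpos i0 i2 Ca).
  - exact: (Cpos i0 i3 Ca).
  - exact: (Cpos i1 i2 Cb).
  - exact: (Cpos i1 i3 Cb).
split=> //; first by apply: oppr_inj; rewrite e2 opprD.
by apply: oppr_inj; rewrite e3 opprD.
Qed.

(* Taking [t = 1] or [t = -1] removes from [g] its positive or negative part. *)
Lemma maximal_cone_part_exists (t : R) g : `|t| = 1 ->
  exists a, [/\ C (t *: a), part a g & forall b, C (t *: b) -> part b (g - a) -> b = 0].
Proof.
move=> t1.
have t0 : t != 0 by rewrite -normr_eq0 t1 oner_eq0.
have [||||a [[Ca ag] _ amax]] := @maximal_part R E [set a | C (t *: a) /\ part a g] 0.
- exact: compE.
- split; first by rewrite scaler0; exact: maximal_cone0.
  by apply: partP; rewrite normr0 add0r subr0.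
- move=> l h; split.
    apply: maximal_cone_approx_closed => e /h[a [[Ca _] la]].
    by exists (t *: a); rewrite -scalerBr normrZ t1 mul1r.
  by apply: part_approx_closed_l => e /h[a [[_ ag] la]]; exists a.
- by exists `|g| => a [_]; rewrite /part => ->; rewrite lerDl.
exists a; split=> // b Cb bga.
have ab : `|a + b| = `|a| + `|b|.
  have := maximal_cone_norm Ca Cb.
  by rewrite -scalerDr !normrZ t1 !mul1r.
apply: (@addrI _ a); rewrite addr0; apply: amax.
  split; first by rewrite scalerDr; exact: maximal_cone_add.
  apply: partP; move: ag bga; rewrite /part ab => -> ->.
  have -> : g - a - b = g - (a + b) by lmodule_eq.
  by rewrite addrA.
by apply: partP; rewrite addrAC subrr add0r ab.
Qed.

(** Remove from [g] a maximal part [p] in [C], then from the rest a maximal part [m] in [- C]; call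
    the remainder [h]. For [c] in [C], what cancels in [c + h] is a part of [c], so in [C], and its
    opposite is a part of [h], so it is 0 by maximality of [m]. Thus [h] can be adjoined to [C], and
    maximality of [p] gives [h = 0]. *)
Lemma maximal_cone_decomposition g :
  exists p n, [/\ C p, C n, g = p - n & `|g| = `|p| + `|n|].
Proof.
have [p [Cp pg pmax]] := @maximal_cone_part_exists 1 g (normr1 _).
have [|m [Cm mgp mmax]] := @maximal_cone_part_exists (-1) (g - p).
  by rewrite normrN1.
rewrite scale1r in Cp; rewrite scaleN1r in Cm.
have h0 : g - p - m = 0.
  set h := g - p - m.
  have hpart : part h (g - p) by exact: part_sub.
  suff Ch : C h by apply: pmax; rewrite ?scale1r.
  apply: maximal_cone_adjoin => c Cc.
  have [w [wc wh ->]] := decomposition3 c h.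
  have -> : w = 0; last by rewrite subr0 addr0.
  apply: oppr_inj; rewrite oppr0; apply: mmax => //.
  by rewrite scaleN1r opprK; exact: maximal_cone_part Cc wc.
exists p, (- m); split=> //.
  by rewrite opprK; apply/eqP; rewrite -subr_eq0 opprD addrA h0.
move: pg mgp; rewrite /part => -> ->.
by rewrite h0 normr0 addr0 normrN.
Qed.

End maximal_cone.

(** * Extension of a measure from a ring of sets *)

(** Besides the extension it keeps the outer measure formula, from which sets of finite measure are
    later approximated by members of the ring. *)
Lemma ring_measure_extension (R : realType) (U : Type) (T := set U) (G : set (set T))
    (m : set T -> \bar R) :
  G set0 -> setU_closed G -> setD_closed G -> m set0 = 0%E ->
  (forall A, 0 <= m A)%E ->
  (forall F : nat -> set T, (forall n, G (F n)) -> trivIset setT F ->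
    G (\bigcup_n F n) ->
    (fun n => \sum_(0 <= i < n) m (F i))%E @ \oo --> m (\bigcup_n F n)) ->
  exists nu : {measure set (g_sigma_algebraType G) -> \bar R},
    (forall A, G A -> nu A = m A) /\
    forall A, nu A = ereal_inf [set (\sum_(k <oo) m (B k))%E | B in
      [set B : nat -> set T | (forall i, G (B i)) /\ A `<=` \bigcup_k B k]].
Proof.
move=> G0 GU GD m0 mge0 madd.
pose d := default_measure_display.
pose T' : ringOfSetsType d :=
  HB.pack (set U) (Pointed.on (set U)) (isRingOfSets.Build d (set U) G0 GU GD).
pose m' : {measure set T' -> \bar R} :=
  HB.pack (m : set T' -> \bar R) (isMeasure.Build d T' R m m0 mge0 madd).
pose nu : {measure set (g_sigma_algebraType (@measurable d T')) -> \bar R} :=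
  measure_extension m'.
exists nu; split=> // A GA.
exact: (@measurable_mu_extE _ _ T' m').
Qed.

(** * The lattice structure *)

Section AL_space.
Context {R : realType} {E : normedModType R}.
Variable C : set E.
Hypothesis maxC : maximal_additive_cone C.
Hypothesis compE : geometric_complete E.
Hypothesis decE : norm_decomposition E 4.
Implicit Types (a b c f g h s u x y z : E) (t : R).

Local Notation "x <<= y" := (C (y - x)) (at level 70).

Let C0 : C 0 := maximal_cone0 maxC.
Let CD a b : C a -> C b -> C (a + b). Proof. exact: maximal_cone_add. Qed.
Let CZ t a : 0 <= t -> C a -> C (t *: a). Proof. exact: maximal_coneZ. Qed.
Let CN a b : C a -> C b -> `|a + b| = `|a| + `|b|. Proof. exact: maximal_cone_norm. Qed.

Lemma cone_le_refl x : x <<= x.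
Proof. by rewrite subrr. Qed.

Lemma cone_le_trans y x z : x <<= y -> y <<= z -> x <<= z.
Proof. by move=> xy yz; have := CD xy yz; rewrite addrC subrKA. Qed.

Lemma cone_le_anti x y : x <<= y -> y <<= x -> x = y.
Proof.
move=> xy yx; apply/eqP; rewrite -subr_eq0; apply/eqP.
by apply: (maximal_cone_pointed maxC) => //; rewrite opprB.
Qed.

Lemma cone_le_norm a b : C a -> a <<= b -> `|b| = `|a| + `|b - a|.
Proof. by move=> Ca ab; rewrite -CN// addrC subrK. Qed.

Lemma cone_le0 a : C a -> a <<= 0 -> a = 0.
Proof. by move=> Ca; rewrite sub0r => Cna; exact: (maximal_cone_pointed maxC). Qed.

Lemma pos_part_exists g : exists p, [/\ C p, C (p - g) & `|g| = `|p| + `|p - g|].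
Proof.
have [p [n [Cp Cn gpn gn]]] := maximal_cone_decomposition maxC compE decE g.
by exists p; have -> : p - g = n by rewrite gpn; lmodule_eq.
Qed.

Definition pos_part g : E := sval (cid (pos_part_exists g)).

Lemma pos_partP g : [/\ C (pos_part g), g <<= pos_part g &
  `|g| = `|pos_part g| + `|pos_part g - g|].
Proof. exact: svalP (cid (pos_part_exists g)). Qed.

(** Riesz' lemma for [p + (u - g) = u + (p - g)]: the component [q] shared by [p] and [p - g] would
    cancel in [g], so the norm identity forces [q = 0], and [u - p] is then one of the
    components. *)
Lemma pos_part_lub g u : C u -> g <<= u -> pos_part g <<= u.
Proof.
have [Cp Cn gN] := pos_partP g; set p := pos_part g in Cp Cn gN *.
move=> Cu Cug.
have [|p' [q [r [s [[Cp' Cq Cr Cs] [pE _ uE nE]]]]]] :=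
  riesz_decomposition maxC decE Cp Cug Cu Cn.
  by lmodule_eq.
have q0 : q = 0.
  apply/eqP; rewrite -normr_eq0 eq_le normr_ge0 andbT.
  have gE : g = p' - s by rewrite -(subKr p g) nE pE; lmodule_eq.
  have := ler_normB p' s; rewrite -gE gN nE pE !CN//; lra.
by rewrite uE pE q0; have -> : p' + r - (p' + 0) = r by lmodule_eq.
Qed.

Definition meet a b := a - pos_part (a - b).
Definition join a b := b + pos_part (a - b).

Lemma meet_lel a b : meet a b <<= a.
Proof.
have [Cp _ _] := pos_partP (a - b).
by rewrite /meet; have -> : a - (a - pos_part (a - b)) = pos_part (a - b) by lmodule_eq.
Qed.

Lemma meet_ler a b : meet a b <<= b.
Proof.
have [_ + _] := pos_partP (a - b); rewrite /meet; congr C; lmodule_eq.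
Qed.

Lemma meet_glb z a b : z <<= a -> z <<= b -> z <<= meet a b.
Proof.
move=> za zb; have : pos_part (a - b) <<= a - z.
  by apply: pos_part_lub => //; move: zb; congr C; lmodule_eq.
by rewrite /meet; congr C; lmodule_eq.
Qed.

Lemma join_lel a b : a <<= join a b.
Proof. by have [_ + _] := pos_partP (a - b); rewrite /join; congr C; lmodule_eq. Qed.

Lemma join_ler a b : b <<= join a b.
Proof. by have [+ _ _] := pos_partP (a - b); rewrite /join; congr C; lmodule_eq. Qed.

Lemma join_lub a b u : a <<= u -> b <<= u -> join a b <<= u.
Proof.
move=> au bu; have : pos_part (a - b) <<= u - b.
  by apply: pos_part_lub => //; move: au; congr C; lmodule_eq.
by rewrite /join; congr C; lmodule_eq.
Qed.

Lemma joinE a b : join a b = a + b - meet a b.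
Proof. by rewrite /join /meet; lmodule_eq. Qed.

Lemma meetC a b : meet a b = meet b a.
Proof.
by apply: cone_le_anti; apply: meet_glb;
  first [exact: meet_lel|exact: meet_ler].
Qed.

Lemma meetZ t a b : 0 < t -> meet (t *: a) (t *: b) = t *: meet a b.
Proof.
have le t' a' b' : 0 < t' -> t' *: meet a' b' <<= meet (t' *: a') (t' *: b').
  move=> t0; apply: meet_glb; rewrite -scalerBr; apply: CZ (ltW t0) _.
    exact: meet_lel.
  exact: meet_ler.
move=> t0; apply: cone_le_anti; last exact: le.
have ti0 : 0 < t^-1 by rewrite invr_gt0.
have := CZ (ltW t0) (le _ (t *: a) (t *: b) ti0).
rewrite !scalerA mulVf ?gt_eqF// !scale1r; congr C.
by lmodule_eq_by ltac:(by field; rewrite gt_eqF).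
Qed.

Lemma meet_ge0 a b : C a -> C b -> C (meet a b).
Proof. by move=> Ca Cb; have := @meet_glb 0 a b; rewrite !subr0; apply. Qed.

Lemma meet_le a b a' b' : a <<= a' -> b <<= b' -> meet a b <<= meet a' b'.
Proof.
move=> aa' bb'; apply: meet_glb.
  exact: cone_le_trans (meet_lel _ _) aa'.
exact: cone_le_trans (meet_ler _ _) bb'.
Qed.

Lemma meet_idl a b : a <<= b -> meet a b = a.
Proof.
move=> ab; apply: cone_le_anti; first exact: meet_lel.
by apply: meet_glb => //; exact: cone_le_refl.
Qed.

Lemma join_ge0 a b : C a -> C (join a b).
Proof. by move=> Ca; have := CD Ca (join_lel a b); rewrite addrC subrK. Qed.

(** It suffices that [u + join a b - y] dominates [join a b], which is checked for [c = a] and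
    [c = b] separately: [y + c] is [join y c + meet y c], where [join y c] is below [join a b] and
    [meet y c] below [u]. *)
Lemma meet_joinr x a b : meet x (join a b) <<= join (meet x a) (meet x b).
Proof.
set y := meet x (join a b); set u := join (meet x a) (meet x b).
have yx : y <<= x by exact: meet_lel.
have yab : y <<= join a b by exact: meet_ler.
have key c : c <<= join a b -> meet x c <<= u -> c <<= u + join a b - y.
  move=> cab xcu.
  have : join y c <<= join a b by exact: join_lub.
  rewrite (joinE y c) => /CD; move/(_ _ (cone_le_trans (meet_le yx (cone_le_refl c)) xcu)).
  by congr C; lmodule_eq.
have : join a b <<= u + join a b - y.
  apply: join_lub; apply: key.
  - exact: join_lel.
  - exact: join_lel.
  - exact: join_ler.
  - exact: join_ler.
by congr C; lmodule_eq.
Qed.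

Definition disjoint a b := meet a b = 0.

Lemma disjointC a b : disjoint a b -> disjoint b a.
Proof. by rewrite /disjoint meetC. Qed.

Lemma disjoint_eq0 a b c : disjoint a b -> C c -> c <<= a -> c <<= b -> c = 0.
Proof.
by move=> ab Cc ca cb; apply: cone_le0 => //; rewrite -ab; exact: meet_glb.
Qed.

Lemma disjointP a b : C a -> C b ->
  (forall c, C c -> c <<= a -> c <<= b -> c = 0) -> disjoint a b.
Proof.
by move=> Ca Cb; apply; [exact: meet_ge0|exact: meet_lel|exact: meet_ler].
Qed.

(** As an identity between norms, disjointness passes to limits. Conversely to the decomposition of
    [a - b], a common minorant [meet a b] cancels in [a - b] and lowers its norm. *)
Lemma disjoint_norm a b : C a -> C b ->
  disjoint a b <-> `|a - b| = `|a| + `|b|.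
Proof.
move=> Ca Cb; split=> [ab|ab].
  have [_ _] := pos_partP (a - b).
  have -> : pos_part (a - b) = a.
    by apply: esym; apply/eqP; rewrite -subr_eq0; apply/eqP.
  by have -> : a - (a - b) = b by lmodule_eq.
have Cm := meet_ge0 Ca Cb.
apply/eqP; rewrite -normr_eq0 eq_le normr_ge0 andbT.
have := ler_normB (a - meet a b) (b - meet a b).
have -> : a - meet a b - (b - meet a b) = a - b by lmodule_eq.
have := cone_le_norm Cm (meet_lel a b); have := cone_le_norm Cm (meet_ler a b); lra.
Qed.

Lemma disjoint_le a a' b : C b -> C a' -> a' <<= a -> disjoint a b -> disjoint a' b.
Proof.
move=> Cb Ca' a'a ab; apply: disjointP => // c Cc ca' cb.
by apply: disjoint_eq0 ab _ _ cb => //; exact: cone_le_trans a'a.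
Qed.

Lemma disjointD a a' b : C a -> C a' -> C b ->
  disjoint a b -> disjoint a' b -> disjoint (a + a') b.
Proof.
move=> Ca Ca' Cb ab a'b; apply: disjointP => //; first exact: CD.
move=> c Cc caa' cb.
have [|p [q [r [s [[Cp Cq Cr Cs] [cE _ aE a'E]]]]]] :=
    riesz_decomposition maxC decE Cc caa' Ca Ca'.
  by lmodule_eq.
have pc : p <<= c by rewrite cE addrAC subrr add0r.
have qc : q <<= c by rewrite cE addrK.
rewrite cE (disjoint_eq0 ab Cp)//; last exact: cone_le_trans cb.
  rewrite (disjoint_eq0 a'b Cq) ?addr0//; last exact: cone_le_trans cb.
  by rewrite a'E addrAC subrr add0r.
by rewrite aE addrAC subrr add0r.
Qed.

(** Both vectors are enlarged by the common factor [1 + t], to which [meetZ] applies; [disjoint_le]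
    brings them down again. *)
Lemma disjointZ t a b : 0 <= t -> C a -> C b -> disjoint a b -> disjoint (t *: a) b.
Proof.
move=> t0 Ca Cb ab.
have t1 : 0 < 1 + t by lra.
apply: (@disjoint_le ((1 + t) *: a)) => //; first exact: CZ.
  by move: Ca; congr C; lmodule_eq.
have tb : b <<= (1 + t) *: b.
  by have := CZ t0 Cb; congr C; lmodule_eq.
have Cta : C ((1 + t) *: a) by apply: CZ => //; exact: ltW.
apply: disjointC; apply: (disjoint_le _ _ tb) => //.
by apply: disjointC; rewrite /disjoint meetZ// ab scaler0.
Qed.

Lemma disjoint_add_le a b s : disjoint a b -> a <<= s -> b <<= s -> a + b <<= s.
Proof. by move=> ab as_ bs; have := join_lub as_ bs; rewrite joinE ab subr0. Qed.

Lemma disjoint_self a : C a -> disjoint a a -> a = 0.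
Proof. by move=> Ca /disjoint_eq0; apply => //; exact: cone_le_refl. Qed.

Lemma disjoint0 a : C a -> disjoint a 0.
Proof. by move=> Ca; apply: disjointP => // c Cc _; exact: cone_le0. Qed.

Lemma meet_disjointD x p q : C x -> C p -> C q -> disjoint p q ->
  meet x (p + q) = meet x p + meet x q.
Proof.
move=> Cx Cp Cq pq.
have pqE : p + q = join p q by rewrite joinE pq subr0.
have pxq : disjoint (meet x p) (meet x q).
  apply: (@disjoint_le p); [exact: meet_ge0|exact: meet_ge0|exact: meet_ler|].
  apply: disjointC; apply: (@disjoint_le q) => //; [exact: meet_ge0|exact: meet_ler|].
  exact: disjointC.
apply: cone_le_anti.
  have := meet_joinr x p q.
  by rewrite -pqE joinE pxq subr0.
apply: disjoint_add_le => //; apply: meet_le; rewrite ?subrr//.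
  by rewrite addrAC subrr add0r.
by rewrite addrK.
Qed.

(* In an [L1] space [a] and [b] are compatible when they agree wherever neither
   of them vanishes. *)
Definition compatible a b := meet (2 *: a) b <<= a /\ meet (2 *: b) a <<= b.

Lemma compatible_sym a b : compatible a b -> compatible b a.
Proof. by case. Qed.

Lemma compatible_refl a : compatible a a.
Proof. by split; exact: meet_ler. Qed.

Lemma joinZ t a b : 0 < t -> join (t *: a) (t *: b) = t *: join a b.
Proof. by move=> t0; rewrite !joinE meetZ//; lmodule_eq. Qed.

Lemma compatible_join a b c : compatible c a -> compatible c b -> compatible c (join a b).
Proof.
move=> [ca ac] [cb bc]; split.
  apply: cone_le_trans (meet_joinr _ _ _) _; exact: join_lub.
rewrite meetC -joinZ//; apply: cone_le_trans (meet_joinr _ _ _) _.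
apply: join_lub; rewrite meetC.
  exact: cone_le_trans ac (join_lel _ _).
exact: cone_le_trans bc (join_ler _ _).
Qed.

(** In an L1 space: [s] times an indicator function. *)
Definition component c s := [/\ C c, c <<= s & disjoint c (s - c)].

(** By compatibility of [s] and [s'], [x = meet (2 *: c) s'] is below [s]; being disjoint from
    [s - c], it satisfies [x + (s - c) <<= s], that is, [x <<= c]. *)
Lemma compatible_component c s s' : C s' -> component c s -> compatible s s' ->
  compatible c s'.
Proof.
move=> Cs' [Cc cs dc] [h1 h2].
have le2 : 2 *: c <<= 2 *: s by rewrite -scalerBr; exact: CZ.
split; last first.
  by apply: cone_le_trans h2; exact: meet_le (cone_le_refl _) cs.
set x := meet _ _.
have Cx : C x by apply: meet_ge0 => //; exact: CZ.
have xs : x <<= s by apply: cone_le_trans h1; exact: meet_le le2 (cone_le_refl _).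
have : disjoint x (s - c).
  apply: (@disjoint_le (2 *: c)) => //; first exact: meet_lel.
  exact: disjointZ.
move=> /disjoint_add_le /(_ xs); rewrite opprB addrC subrK => /(_ Cc).
by congr C; lmodule_eq.
Qed.

(** If [x] is below both [meet a b] and [a - meet a b], then [x + meet a b] is below [a] and below
    [2 *: b], so below [b] by compatibility, hence below [meet a b]. *)
Lemma compatible_meet_component a b : C a -> C b -> compatible a b ->
  component (meet a b) a.
Proof.
move=> Ca Cb [_ ba]; have Cm := meet_ge0 Ca Cb.
have ma := meet_lel a b; have mb := meet_ler a b.
split=> //; apply: disjointP => // x Cx xm xam.
have xma : x + meet a b <<= a by move: xam; congr C; lmodule_eq.
have xmb : x + meet a b <<= b.
  apply: cone_le_trans ba; apply: meet_glb => //.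
  by have := CD mb (cone_le_trans xm mb); congr C; lmodule_eq.
apply: cone_le0 => //; have := meet_glb xma xmb; congr C; lmodule_eq.
Qed.

Lemma component_compl c s : component c s -> component (s - c) s.
Proof.
move=> [Cc cs d]; split=> //.
  by have -> : s - (s - c) = c by lmodule_eq.
have -> : s - (s - c) = c by lmodule_eq.
exact: disjointC.
Qed.

(* [c] is the part of [s] on which [h > t s]: it is [s - d], where [d] is maximal
   among the elements below [s] that are disjoint from [(h - t s)^+]. *)
Lemma component_exists h s : C h -> h != 0 -> h <<= s ->
  exists t c, [/\ 0 < t, component c s, c != 0 & t *: c <<= h].
Proof.
move=> Ch h0 hs.
have Cs : C s by have := CD Ch hs; rewrite addrC subrK.
have hn : 0 < `|h| by rewrite normr_gt0.
have hsn : `|h| <= `|s| by rewrite (cone_le_norm Ch hs) lerDl.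
have sn : 0 < `|s| by exact: lt_le_trans hsn.
(* The factor 1/2 makes the norm of [t *: s] smaller than that of [h], so [h <<= t *: s] fails and
   [k] is nonzero. *)
pose t := `|h| / 2 / `|s|.
have t0 : 0 < t by rewrite !divr_gt0.
pose k := pos_part (h - t *: s); pose l := k - (h - t *: s).
have [Ck Cl kN] := pos_partP (h - t *: s).
rewrite -/k in Ck Cl kN; rewrite -/l in Cl kN.
have kl : disjoint k l.
  apply/disjoint_norm => //; rewrite -kN; congr (`|_|); rewrite /l; lmodule_eq.
have k0 : k != 0.
  apply/eqP => k0.
  have : h <<= t *: s by move: Cl; rewrite /l k0; congr C; lmodule_eq.
  move=> /(cone_le_norm Ch); rewrite normrZ gtr0_norm// /t divfK ?gt_eqF//.
  by have := normr_ge0 (`|h| / 2 / `|s| *: s - h); move: hn; lra.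
have kh : k <<= h.
  apply: pos_part_lub => //; have := CZ (ltW t0) Cs; congr C; lmodule_eq.
have [||||d [[Cd ds dk] _ dmax]] :=
    @maximal_part R E [set d | [/\ C d, d <<= s & disjoint d k]] 0.
- exact: compE.
- by split; rewrite ?subr0//; apply: disjointC; exact: disjoint0.
- move=> x hx.
  have Cx : C x.
    by apply: (maximal_cone_approx_closed maxC) => e /hx[a [[Ca _ _] xa]]; exists a.
  split=> //.
    apply: (maximal_cone_approx_closed maxC) => e /hx[a [[_ Ca _] xa]].
    exists (s - a); split=> //; have -> : s - x - (s - a) = a - x by lmodule_eq.
    by rewrite distrC.
  apply/disjoint_norm => //; apply/eqP; rewrite eq_le ler_normB/=.
  apply/ler_addgt0Pr => e e0.
  have [|a [[Ca _ /(disjoint_norm Ca Ck) ak] xa]] := hx (e / 2); first by rewrite divr_gt0.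
  have := ler_normD (a - x) (x - k); rewrite subrKA.
  have := ler_normD (x - a) a; rewrite subrK (distrC a x); lra.
- exists `|s| => a [Ca as_ _]; rewrite (cone_le_norm Ca as_) lerDl.
  exact: normr_ge0.
have dzero z : C z -> d + z <<= s -> disjoint z k -> z = 0.
  move=> Cz dzs zk; apply: (@addrI _ d); rewrite addr0; apply: dmax.
    by split=> //; [exact: CD|exact: disjointD].
  by apply: partP; rewrite (CN Cd Cz) addrAC subrr add0r.
exists t, (s - d); split=> //.
- apply: component_compl; split=> //; apply: disjointP => // z Cz zd zsd.
  apply: dzero => //; first by move: zsd; congr C; lmodule_eq.
  exact: disjoint_le zd dk.
- apply: contra_neq k0 => sd0.
  apply: (disjoint_eq0 dk) => //; last exact: cone_le_refl.
  have -> : d = s by apply/eqP; rewrite -subr_eq0 -oppr_eq0 opprB sd0.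
  exact: cone_le_trans kh hs.
(* [w] is the excess of [t *: (s - d)] over [h]. It lies below [l], so it is disjoint from [k]; then
   [t^-1 *: w] could be added to [d], and maximality makes it vanish. *)
- pose w := pos_part (t *: (s - d) - h).
  have [Cw hw _] := pos_partP (t *: (s - d) - h); rewrite -/w in Cw hw.
  have Ctsd : C (t *: (s - d)) by apply: CZ (ltW t0) ds.
  have wt : w <<= t *: (s - d).
    by apply: pos_part_lub => //; move: Ch; congr C; lmodule_eq.
  have wl : w <<= l.
    apply: pos_part_lub => //; have := CD Ck (CZ (ltW t0) Cd).
    by rewrite /l; congr C; lmodule_eq.
  have wk : disjoint w k by apply: disjoint_le wl _ => //; exact: disjointC.
  have tw0 : t^-1 *: w = 0.
    have ti0 : 0 <= t^-1 by rewrite invr_ge0 ltW.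
    apply: dzero; [exact: CZ| |exact: disjointZ].
    have := CZ ti0 wt; rewrite scalerBr scalerA mulVf ?gt_eqF// scale1r.
    by congr C; lmodule_eq.
  have w0 : w = 0.
    have /eqP := tw0; rewrite scaler_eq0 invr_eq0 (gt_eqF t0)/= => /eqP //.
  by move: hw; rewrite w0; congr C; lmodule_eq.
Qed.

(** * Compatible families and their Stone space *)

Definition compatible_family (S : set E) :=
  (forall s, S s -> C s) /\ forall a b, S a -> S b -> compatible a b.

Definition maximal_compatible_family (S : set E) :=
  compatible_family S /\ forall D, S `<` D -> ~ compatible_family D.

Lemma maximal_compatible_family_exists : exists S, maximal_compatible_family S.
Proof.
apply: Zorn_bigcup => F FP totF; split.
  by move=> s [X FX Xs]; have [+ _] := FP _ FX; apply.
move=> a b [X FX Xa] [Y FY Yb]; have [XY|YX] := totF _ _ FX FY.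
  by have [_] := FP _ FY; apply => //; exact: XY.
by have [_] := FP _ FX; apply => //; exact: YX.
Qed.

Variable S : set E.
Hypothesis maxS : maximal_compatible_family S.

Let SC s : S s -> C s. Proof. by have [[+ _] _] := maxS; exact. Qed.

Let Scompat a b : S a -> S b -> compatible a b.
Proof. by have [[_ +] _] := maxS; exact. Qed.

Lemma family_adjoin x : C x -> (forall s, S s -> compatible x s) -> S x.
Proof.
move=> Cx xS; have [_ Smax] := maxS; apply: contrapT => nSx.
apply: (Smax (S `|` [set x])).
  by split; [exact: subsetUl|move=> /(_ x) h; apply: nSx; apply: h; right].
split=> [s [Ss|->]//|a b [Sa|->] [Sb|->]]; first exact: SC.
- exact: Scompat.
- by apply: compatible_sym; exact: xS.
- exact: xS.
- exact: compatible_refl.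
Qed.

Lemma family0 : S 0.
Proof.
apply: family_adjoin => // s /SC Cs; split; rewrite ?scaler0.
  by rewrite meet_idl ?subrr// subr0.
by rewrite meetC meet_idl ?sub0r ?subr0// -?scaleNr; apply: CZ.
Qed.

Lemma family_join a b : S a -> S b -> S (join a b).
Proof.
move=> Sa Sb; apply: family_adjoin; first by apply: join_ge0; exact: SC.
by move=> s Ss; apply: compatible_sym; apply: compatible_join; exact: Scompat.
Qed.

Lemma family_component c s : S s -> component c s -> S c.
Proof.
move=> Ss cs; apply: family_adjoin; first by case: cs.
by move=> s' Ss'; apply: compatible_component cs _; [exact: SC|exact: Scompat].
Qed.

Let meet_component a b : S a -> S b -> component (meet a b) a.
Proof. by move=> Sa Sb; apply: compatible_meet_component; [exact: SC|exact: SC|exact: Scompat]. Qed.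

Lemma family_meet a b : S a -> S b -> S (meet a b).
Proof. by move=> Sa Sb; exact: family_component (meet_component Sa Sb). Qed.

Definition diff a b := a - meet a b.

Lemma family_diff a b : S a -> S b -> S (diff a b).
Proof.
by move=> Sa Sb; apply: (family_component Sa); apply: component_compl; exact: meet_component.
Qed.

Lemma diff_le a b : C a -> C b -> diff a b <<= a.
Proof.
move=> Ca Cb; rewrite /diff; have -> : a - (a - meet a b) = meet a b by lmodule_eq.
exact: meet_ge0.
Qed.

Lemma diff_disjoint a b : S a -> S b -> disjoint (diff a b) b.
Proof.
move=> Sa Sb; have [Cm ma d] := meet_component Sa Sb.
apply: disjointP => [//||c Cc cd cb]; first exact: SC.
apply: (disjoint_eq0 d) => //; apply: meet_glb => //.
by apply: cone_le_trans cd _; apply: diff_le; exact: SC.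
Qed.

(** Such an [h] is then disjoint from itself, hence 0: every nonzero element of [C] meets some
    member of [S]. *)
Lemma family_disjoint h : C h -> (forall s, S s -> disjoint h s) -> S h.
Proof.
move=> Ch hS; apply: family_adjoin => // s Ss; have Cs := SC Ss.
have hs : disjoint (2 *: h) s by apply: disjointZ; rewrite ?ler0n//; exact: hS.
have sh : disjoint (2 *: s) h by apply: disjointZ; rewrite ?ler0n//; apply: disjointC; exact: hS.
by split; rewrite (hs, sh) subr0.
Qed.

(** Density of the span of [S] as an induction principle. For [f] in [C] let [a] be maximal in [C]
    and [M] below [f]. A nonzero rest [f - a] would meet some [s] in [S], and [component_exists]
    would give a multiple of a component of [s], again in [M], to add to [a]. *)
Lemma family_span (M : set E) : (forall s, S s -> M s) ->
  (forall t x y, M x -> M y -> M (t *: x + y)) -> approx_closed M -> forall x, M x.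
Proof.
move=> SM Mlin Mcl.
have M0 : M 0 by apply: SM; exact: family0.
have coneM f : C f -> M f.
  move=> Cf.
  have [||||a [[Ca af Ma] _ amax]] :=
      @maximal_part R E [set a | [/\ C a, a <<= f & M a]] 0.
  - exact: compE.
  - by split; rewrite ?subr0.
  - move=> x hx; split.
    + by apply: (maximal_cone_approx_closed maxC) => e /hx[a [[Ca _ _] xa]]; exists a.
    + apply: (maximal_cone_approx_closed maxC) => e /hx[a [[_ Ca _] xa]].
      exists (f - a); split=> //; have -> : f - x - (f - a) = a - x by lmodule_eq.
      by rewrite distrC.
    + by apply: Mcl => e /hx[a [[_ _ Ma] xa]]; exists a.
  - by exists `|f| => a [Ca af _]; rewrite (cone_le_norm Ca af) lerDl normr_ge0.
  suff -> : f = a by [].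
  apply/eqP; rewrite -subr_eq0; apply/eqP; apply: contrapT => h0.
  set h := f - a in af h0; apply: h0.
  have [hS|] := pselect (forall s, S s -> disjoint h s).
    exact: disjoint_self af (hS _ (family_disjoint af hS)).
  move=> /existsNP[s /not_implyP[Ss hs]]; have Cs := SC Ss.
  have ms := meet_ler h s; have mh := meet_lel h s.
  have [|t [c [t0 cs c0 tc]]] := component_exists (meet_ge0 af Cs) _ ms.
    exact/eqP.
  have Cc : C c by case: cs.
  have Ctc : C (t *: c) by apply: CZ (ltW t0) Cc.
  exfalso; move: c0; suff -> : c = 0 by rewrite eqxx.
  apply/eqP; suff : t *: c == 0 by rewrite scaler_eq0 gt_eqF.
  apply/eqP; apply: (@addrI _ a); rewrite addr0; apply: amax.
    split; first exact: CD.
      by have := cone_le_trans tc mh; rewrite /h; congr C; lmodule_eq.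
    rewrite addrC; apply: Mlin => //; apply: SM; exact: family_component cs.
  by apply: partP; rewrite (CN Ca Ctc) addrAC subrr add0r.
move=> x; have [p [n [Cp Cn -> _]]] := maximal_cone_decomposition maxC compE decE x.
by rewrite addrC -scaleN1r; apply: Mlin; exact: coneM.
Qed.

(* The points of the Stone space of the Boolean ring [S] are its prime filters. *)
Definition prime_filter (chi : set E) :=
  [/\ chi `<=` S, ~ chi 0, forall a b, chi a -> chi b -> chi (meet a b),
      forall a b, chi a -> S b -> a <<= b -> chi b
    & forall a b, chi a -> S b -> chi b \/ chi (diff a b)].

Definition hat a : set (set E) := [set chi | prime_filter chi /\ chi a].

Lemma hat0 : hat 0 = set0.
Proof. by apply/seteqP; split=> // chi [[]]. Qed.

Lemma hat_le a b : S b -> a <<= b -> hat a `<=` hat b.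
Proof.
move=> Sb ab chi [chiP chia]; split=> //.
by have [_ _ _ + _] := chiP; apply; [exact: chia| |].
Qed.

Lemma hat_meet a b : S a -> S b -> hat (meet a b) = hat a `&` hat b.
Proof.
move=> Sa Sb; apply/seteqP; split=> chi.
  by move=> h; split; apply: hat_le h => //; [exact: meet_lel|exact: meet_ler].
by move=> [[chiP ca] [_ cb]]; split=> //; have [_ _ + _ _] := chiP; apply.
Qed.

Lemma hat_diff a b : S a -> S b -> hat (diff a b) = hat a `\` hat b.
Proof.
move=> Sa Sb; have Sab := family_diff Sa Sb.
apply/seteqP; split=> chi.
  move=> cab; split.
    by apply: hat_le cab => //; apply: diff_le; exact: SC.
  move=> cb; have : hat (meet (diff a b) b) chi by rewrite hat_meet.
  by rewrite (diff_disjoint Sa Sb) hat0.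
move=> [[chiP ca] ncb]; split=> //; have [_ _ _ _] := chiP.
by move=> /(_ a b ca Sb)[cb|//]; exfalso; apply: ncb.
Qed.

Lemma hat_join a b : S a -> S b -> hat (join a b) = hat a `|` hat b.
Proof.
move=> Sa Sb; have Sj := family_join Sa Sb.
apply/seteqP; split=> chi; last first.
  by move=> [|]; apply: hat_le => //; [exact: join_lel|exact: join_ler].
move=> cj; have [ca|nca] := pselect (hat a chi); [by left|right].
have : hat (diff (join a b) a) chi by rewrite hat_diff.
apply: hat_le => //; rewrite /diff joinE.
have -> : meet (a + b - meet a b) a = a.
  by rewrite -joinE meetC meet_idl//; exact: join_lel.
by have := meet_ge0 (SC Sa) (SC Sb); congr C; lmodule_eq.
Qed.

Definition proper_filter (F : set E) :=
  [/\ F `<=` S, ~ F 0, forall a b, F a -> F b -> F (meet a b)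
    & forall a b, F a -> S b -> a <<= b -> F b].

(** A maximal proper filter is prime: if it does not contain [b], some [x] in it has [meet x b = 0],
    as otherwise adding [b] would generate a larger proper filter; for [a] in it, [meet a x] is then
    below [diff a b]. *)
Lemma prime_filter_exists (F0 : set E) : proper_filter F0 ->
  exists chi, prime_filter chi /\ F0 `<=` chi.
Proof.
move=> F0P.
(* Only the union with [F0] is asked to be a proper filter, so that the empty chain is covered. *)
have [|A [AP Amax]] := @Zorn_bigcup _ [set F | proper_filter (F `|` F0)].
  move=> F FP totF.
  have [[Z0 FZ0]|nF] := pselect (F !=set0); last first.
    rewrite /= (_ : (\bigcup_(X in F) X) `|` F0 = F0)//.
    by apply/seteqP; split=> x; [move=> [[X FX]|//]; exfalso; apply: nF; exists X|right].
  have two a b : ((\bigcup_(X in F) X) `|` F0) a -> ((\bigcup_(X in F) X) `|` F0) b ->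
      exists2 Z, F Z & (Z `|` F0) a /\ (Z `|` F0) b.
    move=> [[X FX Xa]|a0] [[Y FY Yb]|b0].
    - have [XY|YX] := totF _ _ FX FY.
        by exists Y => //; split; left => //; exact: XY.
      by exists X => //; split; left => //; exact: YX.
    - by exists X => //; split; [left|right].
    - by exists Y => //; split; [right|left].
    - by exists Z0 => //; split; right.
  have sub Z x : F Z -> (Z `|` F0) x -> ((\bigcup_(X in F) X) `|` F0) x.
    by move=> FZ [Zx|]; [left; exists Z|right].
  split.
  - by move=> x fx; have [Z FZ [Zx _]] := two _ _ fx fx; have [+ _ _ _] := FP _ FZ; apply.
  - by move=> f0; have [Z FZ [Z0' _]] := two _ _ f0 f0; have [_ + _ _] := FP _ FZ; apply.
  - move=> a b fa fb; have [Z FZ [Za Zb]] := two _ _ fa fb; apply: (sub Z) => //.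
    by have [_ _ + _] := FP _ FZ; apply.
  - move=> a b fa Sb ab; have [Z FZ [Za _]] := two _ _ fa fa; apply: (sub Z) => //.
    by have [_ _ _] := FP _ FZ; apply; [exact: Za| |].
have [AS A0 Am Au] := AP; set chi := A `|` F0 in AP AS A0 Am Au.
have chi_max G : proper_filter G -> chi `<=` G -> G `<=` chi.
  move=> GP cG x Gx; apply: contrapT => ncx; apply: (Amax G).
    by split; [move=> y Ay; apply: cG; left|move=> /(_ x Gx) Ax; apply: ncx; left].
  rewrite /= (_ : G `|` F0 = G)//.
  by apply/seteqP; split=> y; [move=> [//|F0y]; apply: cG; right|left].
exists chi; split; last by move=> x; right.
split=> // a b ca Sb.
have [cb|ncb] := pselect (chi b); [by left|right].
have Sa := AS _ ca; have Ca := SC Sa; have Cb := SC Sb.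
have [x cx xb0] : exists2 x, chi x & meet x b = 0.
  apply: contrapT => h.
  pose G := [set y | S y /\ exists2 x, chi x & meet x b <<= y].
  have GP : proper_filter G.
    split=> [y []//|[_ [x cx xb]]|y z [Sy [x cx xy]] [Sz [x' cx' xz]]|y z [Sy [x cx xy]] Sz yz].
    - apply: h; exists x => //; apply: cone_le0 xb.
      by apply: meet_ge0 => //; apply: SC; exact: AS.
    - split; first exact: family_meet.
      exists (meet x x'); first exact: Am.
      apply: meet_glb.
        by apply: cone_le_trans xy; apply: meet_le; [exact: meet_lel|exact: cone_le_refl].
      by apply: cone_le_trans xz; apply: meet_le; [exact: meet_ler|exact: cone_le_refl].
    - by split=> //; exists x => //; exact: cone_le_trans yz.
  apply: ncb; apply: (chi_max G) => //.
    by move=> y cy; split; [exact: AS|exists y => //; exact: meet_lel].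
  by split=> //; exists a => //; exact: meet_ler.
have Cx := SC (AS _ cx).
apply: (Au (meet a x)); [exact: Am|exact: family_diff|].
have axb : disjoint (meet a x) (meet a b).
  apply: (@disjoint_le x); [exact: meet_ge0|exact: meet_ge0|exact: meet_ler|].
  apply: disjointC; apply: (@disjoint_le b) => //; [exact: meet_ge0|exact: meet_ler|].
  exact: disjointC.
have := disjoint_add_le axb (meet_lel a x) (meet_lel a b).
by rewrite /diff; congr C; lmodule_eq.
Qed.

Fixpoint joins (b : nat -> E) n :=
  if n is m.+1 then join (joins b m) (b m) else 0.

Lemma family_joins (b : nat -> E) n : (forall i, S (b i)) -> S (joins b n).
Proof.
by move=> Sb; elim: n => [|n IH] /=; [exact: family0|exact: family_join].
Qed.

Lemma joins_le (b : nat -> E) n m : (n <= m)%N -> joins b n <<= joins b m.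
Proof.
move=> /subnKC <-; elim: (m - n)%N => [|k IH]; first by rewrite addn0; exact: cone_le_refl.
by rewrite addnS; apply: cone_le_trans IH _; exact: join_lel.
Qed.

Lemma hat_joins (b : nat -> E) n : (forall i, S (b i)) ->
  hat (joins b n) = \bigcup_(i < n) hat (b i).
Proof.
move=> Sb; elim: n => [|n IH] /=.
  by rewrite hat0 bigcup_mkord big_ord0.
rewrite hat_join//; last exact: family_joins.
by rewrite IH !bigcup_mkord big_ord_recr.
Qed.

(** If no finite join dominates [a], the remainders [diff a (joins b n)] generate a proper filter; a
    prime filter containing it is a point of [hat a] outside every [hat (b n)]. *)
Lemma hat_compact a (b : nat -> E) : S a -> (forall i, S (b i)) ->
  hat a `<=` \bigcup_i hat (b i) -> exists n, a <<= joins b n.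
Proof.
move=> Sa Sb; apply: contraPP => /forallNP nab cover.
have Ca := SC Sa; have SJ n := family_joins n Sb.
pose e n := diff a (joins b n).
have Ce n : C (e n) := meet_lel a (joins b n).
have e_le n m : (n <= m)%N -> e m <<= e n.
  move=> nm; have := meet_le (cone_le_refl a) (joins_le b nm).
  by rewrite /e /diff; congr C; lmodule_eq.
have [|chi [chiP F0chi]] := @prime_filter_exists [set x | S x /\ exists n, e n <<= x].
  split=> [x []//|[_ [n en]]|x y [Sx [n nx]] [Sy [m my]]|x y [Sx [n nx]] Sy xy].
  - apply: (nab n); have := cone_le0 (Ce n) en.
    by move=> /eqP; rewrite subr_eq0 => /eqP ->; exact: meet_ler.
  - split; first exact: family_meet.
    exists (maxn n m); apply: meet_glb.
      exact: cone_le_trans (e_le _ _ (leq_maxl _ _)) nx.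
    exact: cone_le_trans (e_le _ _ (leq_maxr _ _)) my.
  - by split=> //; exists n; exact: cone_le_trans xy.
have chie n : hat (e n) chi.
  split=> //; apply: F0chi; split; first exact: family_diff.
  by exists n; exact: cone_le_refl.
have chia : hat a chi.
  by apply: hat_le (chie 0%N) => //; apply: diff_le => //; exact: SC.
have [n _ chib] := cover _ chia.
(* The index is [n.+1] because [joins b n] stops before [b n]. *)
have := chie n.+1; rewrite /e hat_diff// => -[_]; apply.
by apply: hat_le chib => //; exact: join_ler.
Qed.

Lemma hat_subset a b : S a -> S b -> hat a `<=` hat b -> a <<= b.
Proof.
move=> Sa Sb ab.
have [|n an] := @hat_compact a (fun=> b) Sa (fun=> Sb).
  by move=> chi /ab; exists 0%N.
apply: cone_le_trans an _; elim: n => [|n IH] /=; first by rewrite subr0; exact: SC.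
by apply: join_lub => //; exact: cone_le_refl.
Qed.

Lemma hat_inj a b : S a -> S b -> hat a = hat b -> a = b.
Proof. by move=> Sa Sb ab; apply: cone_le_anti; apply: hat_subset; rewrite ?ab. Qed.

Lemma joins_norm_disjoint (b : nat -> E) n : (forall i, S (b i)) -> trivIset setT (hat \o b) ->
  `|joins b n| = \sum_(0 <= i < n) `|b i|.
Proof.
move=> Sb tb; elim: n => [|n IH] /=; first by rewrite normr0 big_nil.
have SJ := family_joins n Sb; have CJ := SC SJ; have Cb := SC (Sb n).
rewrite big_nat_recr//= -IH joinE -CN//; congr (`|_|).
suff -> : meet (joins b n) (b n) = 0 by rewrite subr0.
apply: hat_inj; [exact: family_meet|exact: family0|].
rewrite hat_meet// hat_joins// hat0 -subset0 => chi [[i /= im ci] cn].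
have iE : i = n by apply: tb => //; exists chi.
by move: im; rewrite iE ltnn.
Qed.

(** The Stone space enters what follows only through [h]. By compactness a disjoint countable union
    lying in the ring has eventually constant partial sums. For the approximation, the outer measure
    formula covers [A] by sets of the ring with excess at most [e / 2], and a finite join of them
    misses at most [e / 2] of the cover. *)
Lemma stone_measure : exists (d : measure_display) (T : measurableType d)
    (nu : {measure set T -> \bar R}) (h : E -> set T),
  [/\ forall a, S a -> measurable (h a) /\ nu (h a) = `|a|%:E,
      h 0 = set0,
      forall a b, S a -> S b -> h (meet a b) = h a `&` h b,
      forall a b, S a -> S b -> h (diff a b) = h a `\` h b
    & forall A, measurable A -> (nu A < +oo)%E -> forall e, 0 < e ->
        exists2 s, S s & (nu (A `\` h s) + nu (h s `\` A) <= e%:E)%E].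
Proof.
pose G : set (set (set E)) := [set hat a | a in S].
(* [elt] inverts [hat]; off the ring its default 0 makes [m] vanish. *)
pose elt A : E := xget 0 [set a | S a /\ hat a = A].
have eltP a : S a -> elt (hat a) = a.
  move=> Sa; rewrite /elt; case: xgetP => [b _ [Sb ba]|/(_ a)]; last by case.
  exact: hat_inj.
pose m A : \bar R := `|elt A|%:E.
have mE a : S a -> m (hat a) = `|a|%:E by move=> Sa; rewrite /m eltP.
have G0 : G set0 by exists 0; [exact: family0|exact: hat0].
have GU : setU_closed G.
  move=> _ _ [a Sa <-] [b Sb <-]; exists (join a b); first exact: family_join.
  exact: hat_join.
have GD : setD_closed G.
  move=> _ _ [a Sa <-] [b Sb <-]; exists (diff a b); first exact: family_diff.
  exact: hat_diff.
have m0 : m set0 = 0%E by rewrite -hat0 mE ?normr0//; exact: family0.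
have mge0 A : (0 <= m A)%E by rewrite lee_fin.
have madd (F : nat -> set (set E)) : (forall n, G (F n)) -> trivIset setT F ->
    G (\bigcup_n F n) ->
    (fun n => \sum_(0 <= i < n) m (F i))%E @ \oo --> m (\bigcup_n F n).
  move=> GF tF [a Sa aF].
  have /choice[b bP] : forall n, exists b, S b /\ hat b = F n.
    by move=> n; have [b Sb bF] := GF n; exists b.
  have Sb n : S (b n) by case: (bP n).
  have FE : F = hat \o b by apply/funext => n /=; case: (bP n).
  have [|N aN] := hat_compact Sa Sb; first by rewrite aF FE.
  have Ja n : joins b n <<= a.
    apply: hat_subset => //; first exact: family_joins.
    rewrite hat_joins// aF FE => chi [i _ ci]; by exists i.
  rewrite -aF mE//; apply: cvg_near_cst; near=> n.
  have -> : a = joins b n.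
    apply: cone_le_anti => //; apply: cone_le_trans aN _; apply: joins_le.
    by near: n; exact: nbhs_infty_ge.
  rewrite joins_norm_disjoint//; last by rewrite -FE.
  by rewrite -sumEFin FE; apply: eq_bigr => i _ /=; rewrite mE.
have [nu [nuG nuE]] := ring_measure_extension G0 GU GD m0 mge0 madd.
have mhat a : S a -> measurable (hat a : set (g_sigma_algebraType G)).
  by move=> Sa; apply: sub_sigma_algebra; exists a.
have nuhat a : S a -> nu (hat a) = `|a|%:E.
  by move=> Sa; rewrite nuG ?mE//; exists a.
exists _, (g_sigma_algebraType G), nu, hat; split.
- by move=> a Sa; split; [exact: mhat|exact: nuhat].
- exact: hat0.
- exact: hat_meet.
- exact: hat_diff.
move=> A mA finA e e0.
have finA' : nu A \is a fin_num by rewrite ge0_fin_numE.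
have e20 : 0 < e / 2 by rewrite divr_gt0.
have [_ [B [GB AB] <-]] : exists2 x, [set (\sum_(k <oo) m (B k))%E | B in
    [set B : nat -> set (set E) | (forall i, G (B i)) /\ A `<=` \bigcup_k B k]] x &
    (x < nu A + (e / 2)%:E)%E.
  by rewrite nuE; apply: lb_ereal_inf_adherent; rewrite -?nuE.
move=> /ltW Be.
have /choice[b bP] : forall n, exists b, S b /\ hat b = B n.
  by move=> n; have [b Sb bF] := GB n; exists b.
have Sb n : S (b n) by case: (bP n).
have BE : B = hat \o b by apply/funext => n /=; case: (bP n).
pose U : set (g_sigma_algebraType G) := \bigcup_n hat (b n).
have mU : measurable U by apply: bigcup_measurable => n _; exact: mhat.
have AU : A `<=` U by rewrite /U; move: AB; rewrite BE.
have nuU : (nu U <= nu A + (e / 2)%:E)%E.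
  apply: le_trans Be; rewrite BE.
  rewrite (eq_eseriesr (g := fun k => nu (hat (b k)))) => [|k _]; last first.
    by rewrite /= mE// nuhat.
  by apply: measure_sigma_subadditive => // k; exact: mhat.
have finU : nu U \is a fin_num.
  rewrite ge0_fin_numE// (le_lt_trans nuU)// -(fineK finA') -EFinD ltry//.
have cvgU : nu \o (fun n => hat (joins b n)) @ \oo --> nu U.
  have UE : U = \bigcup_n hat (joins b n).
    apply/seteqP; split=> chi [n _ chin].
      by exists n.+1 => //; rewrite hat_joins//; exists n => /=.
    by move: chin; rewrite hat_joins// => -[i _ ci]; exists i.
  rewrite UE; apply: nondecreasing_cvg_mu.
  - by move=> n; apply: mhat; exact: family_joins.
  - by rewrite -UE.
  - move=> n k nk; apply/subsetPset; apply: hat_le; first exact: family_joins.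
    exact: joins_le.
have [n nP] : exists n, (nu U - (e / 2)%:E <= nu (hat (joins b n)))%E.
  have /fine_cvgP[_ /cvgrPdist_le /(_ _ e20)[N _ NP]] :
      nu \o (fun n => hat (joins b n)) @ \oo --> (fine (nu U))%:E.
    by rewrite fineK.
  exists N; have := NP N (leqnn N) => /=; rewrite nuhat/=; last exact: family_joins.
  move=> h; rewrite -(fineK finU) -EFinB lee_fin.
  by have := le_trans (ler_norm _) h; lra.
have SJ := family_joins n Sb.
set V := hat (joins b n) in nP *.
have mV : measurable (V : set (g_sigma_algebraType G)) by exact: mhat.
have VU : V `<=` U by rewrite /V hat_joins// => chi [i _ ci]; exists i.
have finV : nu V \is a fin_num by rewrite nuhat.
have split_nu (W : set (g_sigma_algebraType G)) : measurable W -> W `<=` U ->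
    nu W \is a fin_num -> nu (U `\` W) = (nu U - nu W)%E.
  move=> mW WU finW; rewrite measureD//; last by rewrite ltey_eq finU.
  by rewrite setIidr.
exists (joins b n) => //; rewrite (splitr e) EFinD leeD//.
  apply: (@le_trans _ _ (nu (U `\` V))).
    by apply: le_measure; rewrite ?inE; [exact: measurableD|exact: measurableD|exact: setSD].
  rewrite split_nu//; move: nP; rewrite -(fineK finU) -(fineK finV) -!EFinB !lee_fin; lra.
apply: (@le_trans _ _ (nu (U `\` A))).
  by apply: le_measure; rewrite ?inE; [exact: measurableD|exact: measurableD|exact: setSD].
rewrite split_nu//; move: nuU; rewrite -(fineK finU) -(fineK finA') -!EFinB -EFinD !lee_fin; lra.
Unshelve. all: by end_near. Qed.

(** * Norms of combinations of compatible elements *)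

(** The order ideal generated by [u], described without an absolute value. *)
Definition supported x u := exists2 t, 0 <= t & x <<= t *: u /\ - x <<= t *: u.

Lemma supportedD x y u : supported x u -> supported y u -> supported (x + y) u.
Proof.
move=> [t t0 [h1 h2]] [s s0 [k1 k2]]; exists (t + s); first exact: addr_ge0.
by split; [have := CD h1 k1|have := CD h2 k2]; congr C; lmodule_eq.
Qed.

Lemma supportedZ t x u : supported x u -> supported (t *: x) u.
Proof.
move=> [s s0 [h1 h2]]; exists (`|t| * s); first by rewrite mulr_ge0.
have [t0|t0] := leP 0 t.
  rewrite ger0_norm//; split; [have := CZ t0 h1|have := CZ t0 h2]; congr C; lmodule_eq.
have nt0 : 0 <= - t by rewrite oppr_ge0 ltW.
rewrite ltr0_norm//; split; [have := CZ nt0 h2|have := CZ nt0 h1]; congr C; lmodule_eq.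
Qed.

Lemma supported_le x u : C x -> C u -> x <<= u -> supported x u.
Proof.
move=> Cx Cu xu; exists 1 => //; rewrite scale1r; split=> //.
by have := CD Cu Cx; congr C; lmodule_eq.
Qed.

Lemma supported_parts x u : C u -> supported x u -> exists p n t,
  [/\ C p /\ C n, x = p - n /\ `|x| = `|p| + `|n|, 0 <= t & p <<= t *: u /\ n <<= t *: u].
Proof.
move=> Cu [t t0 [xtu nxtu]]; have Ctu := CZ t0 Cu.
have [Cp Cn xN] := pos_partP x; exists (pos_part x), (pos_part x - x), t.
split=> //; first by split=> //; lmodule_eq.
split; first exact: pos_part_lub.
have : pos_part x <<= t *: u + x.
  apply: pos_part_lub; first by move: nxtu; congr C; lmodule_eq.
  by move: Ctu; congr C; lmodule_eq.
by congr C; lmodule_eq.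
Qed.

(** The positive and negative parts of [x] and [y] are four pairwise disjoint elements, so [p + q]
    and [n + m] are disjoint and [disjoint_norm] applies. *)
Lemma supported_disjoint_norm x y u v : C u -> C v -> disjoint u v ->
  supported x u -> supported y v -> `|x + y| = `|x| + `|y|.
Proof.
move=> Cu Cv uv xu yv.
have [p [n [t [[Cp Cn] [-> xN] t0 [pu nu]]]]] := supported_parts Cu xu.
have [q [m [s [[Cq Cm] [-> yN] s0 [qv mv]]]]] := supported_parts Cv yv.
have Ctu := CZ t0 Cu; have Csv := CZ s0 Cv.
have tusv : disjoint (t *: u) (s *: v).
  by apply: disjointZ => //; apply: disjointC; apply: disjointZ => //; exact: disjointC.
have disj a b : C a -> C b -> a <<= t *: u -> b <<= s *: v -> disjoint a b.
  move=> Ca Cb au bv; apply: (disjoint_le Cb Ca au).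
  by apply: disjointC; apply: (disjoint_le Ctu Cb bv); exact: disjointC.
have pn : disjoint p n by apply/disjoint_norm.
have qm : disjoint q m by apply/disjoint_norm.
have -> : p - n + (q - m) = (p + q) - (n + m) by lmodule_eq.
have -> : `|p + q - (n + m)| = `|p + q| + `|n + m|.
  apply/disjoint_norm; [exact: CD|exact: CD|].
  have Cnm := CD Cn Cm.
  apply: disjointD => //; apply: disjointC; apply: disjointD => //; apply: disjointC => //.
  - exact: disj.
  - by apply: disjointC; exact: disj.
by rewrite xN yN !CN//; lra.
Qed.

(* The constant [k] makes the induction on [l] work: [u] is split along the first
   element [s] of [l], whose coefficient is absorbed by [k] on [meet u s]. *)
Lemma combination_norm_on d (T : measurableType d) (nu : {measure set T -> \bar R})
    (h : E -> set T) (l : seq (R * {s | S s})) u (k : R) :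
  (forall a, S a -> measurable (h a) /\ nu (h a) = `|a|%:E) ->
  (forall a b, S a -> S b -> h (meet a b) = h a `&` h b) ->
  (forall a b, S a -> S b -> h (diff a b) = h a `\` h b) -> S u ->
  (\int[nu]_(x in h u) `|\sum_(p <- l) p.1 * \1_(h (sval p.2)) x + k|%:E =
   `|\sum_(p <- l) p.1 *: meet (sval p.2) u + k *: u|%:E)%E.
Proof.
move=> hP hI hD; elim: l u k => [|[r [s Ss]] l IH] u c Su.
  rewrite big_nil add0r normrZ.
  under eq_integral do rewrite big_nil add0r.
  rewrite integral_cst; last exact: (hP _ Su).1.
  by rewrite (hP _ Su).2.
have Cs := SC Ss; have Cu := SC Su.
have Sm := family_meet Su Ss; have Sd := family_diff Su Ss.
have Cm := SC Sm; have Cd := SC Sd.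
have uE : h u = h (meet u s) `|` h (diff u s) by rewrite hI// hD// setUIDK.
have mf (c' : R) (l' : seq (R * {s | S s})) (D : set T) :
    measurable_fun D (fun x : T => `|\sum_(p <- l') p.1 * \1_(h (sval p.2)) x + c'|%:E).
  apply: measurable_funTS; apply/measurable_EFinP; apply: measurableT_comp => //.
  apply: measurable_funD => //; apply: measurable_sum => p.
  apply: measurable_funM => //; apply: measurable_indic; exact: (hP _ (svalP p.2)).1.
rewrite [in LHS]uE ge0_integral_setU//=; last 3 first.
- exact: (hP _ Sm).1.
- exact: (hP _ Sd).1.
- rewrite hI// hD//; apply/disj_setPS => x [[_ xs] [_ nxs]]; exact: nxs.
have -> : (\int[nu]_(x in h (meet u s))
     `|\sum_(p <- (r, exist _ s Ss) :: l) p.1 * \1_(h (sval p.2)) x + c|%:E =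
   `|\sum_(p <- l) p.1 *: meet (sval p.2) (meet u s) + (r + c) *: meet u s|%:E)%E.
  rewrite -IH//; apply: eq_integral => x; rewrite inE hI// => -[_ xs].
  rewrite big_cons/= indicE mem_set// mulr1; congr (`|_|%:E); ring.
have -> : (\int[nu]_(x in h (diff u s))
     `|\sum_(p <- (r, exist _ s Ss) :: l) p.1 * \1_(h (sval p.2)) x + c|%:E =
   `|\sum_(p <- l) p.1 *: meet (sval p.2) (diff u s) + c *: diff u s|%:E)%E.
  rewrite -IH//; apply: eq_integral => x; rewrite inE hD// => -[_ nxs].
  by rewrite big_cons/= indicE memNset// mulr0 add0r.
have dms : disjoint (meet u s) (diff u s).
  apply: disjointC; apply: disjointC; apply: (@disjoint_le s) => //; first exact: meet_ler.
  by apply: disjointC; exact: diff_disjoint.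
have usE : u = meet u s + diff u s by rewrite /diff; lmodule_eq.
have sup v (c' : R) : S v ->
    supported (\sum_(p <- l) p.1 *: meet (sval p.2) v + c' *: v) v.
  move=> Sv; have Cv := SC Sv.
  apply: supportedD; last first.
    by apply: supportedZ; apply: supported_le => //; exact: cone_le_refl.
  elim: l {IH mf} => [|p l' IHl]; rewrite ?big_nil ?big_cons.
    by exists 0 => //; rewrite scale0r !oppr0 !addr0; split.
  apply: supportedD => //; apply: supportedZ; apply: supported_le => //.
    by apply: meet_ge0 => //; exact: SC (svalP p.2).
  exact: meet_ler.
rewrite -EFinD -(supported_disjoint_norm Cm Cd dms (sup _ _ Sm) (sup _ _ Sd)).
congr (`|_|%:E); rewrite big_cons/= [meet s u]meetC.
have -> : \sum_(p <- l) p.1 *: meet (sval p.2) u =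
    \sum_(p <- l) p.1 *: meet (sval p.2) (meet u s) +
    \sum_(p <- l) p.1 *: meet (sval p.2) (diff u s).
  rewrite -big_split; apply: eq_bigr => p _ /=; rewrite -scalerDr {1}usE.
  by rewrite meet_disjointD//; exact: SC (svalP p.2).
have uE' : c *: u = c *: meet u s + c *: diff u s by rewrite -scalerDr -usE.
rewrite uE'.
move: (\sum_(p <- l) p.1 *: meet (sval p.2) (meet u s)) => v1.
move: (\sum_(p <- l) p.1 *: meet (sval p.2) (diff u s)) => v2.
lmodule_eq.
Qed.

(** The case [k = 0] of [combination_norm_on], with [u] in [S] above all elements of the list: the
    function vanishes off [h u], and taking the meet with [u] changes nothing. *)
Lemma combination_norm d (T : measurableType d) (nu : {measure set T -> \bar R})
    (h : E -> set T) (l : seq (R * {s | S s})) :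
  (forall a, S a -> measurable (h a) /\ nu (h a) = `|a|%:E) ->
  (forall a b, S a -> S b -> h (meet a b) = h a `&` h b) ->
  (forall a b, S a -> S b -> h (diff a b) = h a `\` h b) ->
  (\int[nu]_x `|\sum_(p <- l) p.1 * \1_(h (sval p.2)) x|%:E =
   `|\sum_(p <- l) p.1 *: sval p.2|%:E)%E.
Proof.
move=> hP hI hD.
(* Quantifying over all [v] above [u] lets the induction pass to a larger join. *)
have [u Su /(_ u Su (cone_le_refl u))[u0 uE]] : exists2 u, S u &
    forall v, S v -> u <<= v ->
      (forall w : T, ~ h v w -> \sum_(p <- l) p.1 * \1_(h (sval p.2)) w = 0 :> R) /\
      \sum_(p <- l) p.1 *: meet (sval p.2) v = \sum_(p <- l) p.1 *: sval p.2.
  elim: l => [|[r [s Ss]] l [u Su IH]].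
    exists 0; first exact: family0.
    by move=> v _ _; split=> [w _|]; rewrite !big_nil.
  exists (join s u) => [|v Sv jv]; first exact: family_join.
  have sv : s <<= v by exact: cone_le_trans (join_lel _ _) jv.
  have [v0 vE] := IH v Sv (cone_le_trans (join_ler _ _) jv).
  split=> [w nvw|]; rewrite !big_cons/=; last by rewrite vE meet_idl.
  rewrite v0// addr0 indicE memNset ?mulr0// => sw; apply: nvw.
  by move: sw; rewrite -{1}(meet_idl sv) hI// => -[].
have := combination_norm_on l 0 hP hI hD Su.
rewrite scale0r addr0 uE => <-.
rewrite [RHS]integral_mkcond; apply: eq_integral => w _.
rewrite patchE; case: ifPn => [_|]; first by rewrite addr0.
by rewrite notin_setE => nuw; rewrite u0// normr0.
Qed.

End AL_space.

(** * Representation as a space of integrable functions *)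

Section generators.
Context {R : realType} {A : Type} {E : normedModType R}.
Variable a : A -> E.

Definition combination (l : seq (R * A)) := \sum_(p <- l) p.1 *: a p.2.

Definition approximable x := forall e, 0 < e -> exists l, `|x - combination l| < e.

Lemma combinationZD (t : R) l1 l2 : combination ([seq (t * p.1, p.2) | p <- l1] ++ l2) =
  t *: combination l1 + combination l2.
Proof.
rewrite /combination big_cat big_map scaler_sumr; congr (_ + _).
by apply: eq_bigr => p _; rewrite scalerA.
Qed.

Lemma approximable_generator i : approximable (a i).
Proof.
move=> e e0; exists [:: (1, i)].
by rewrite /combination big_seq1 scale1r subrr normr0.
Qed.

Lemma approximable_lin (t : R) x y : approximable x -> approximable y ->
  approximable (t *: x + y).
Proof.
move=> ax ay e e0.
have t1 : 0 < `|t| + 1 by have := normr_ge0 t; lra.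
have [|l1 l1P] := ax (e / 2 / (`|t| + 1)); first by rewrite !divr_gt0.
have [|l2 l2P] := ay (e / 2); first by rewrite divr_gt0.
exists ([seq (t * p.1, p.2) | p <- l1] ++ l2); rewrite combinationZD.
have -> : t *: x + y - (t *: combination l1 + combination l2) =
  t *: (x - combination l1) + (y - combination l2) by lmodule_eq.
rewrite (le_lt_trans (ler_normD _ _))// normrZ (splitr e) ler_ltD//.
rewrite (le_trans (ler_wpM2l (normr_ge0 t) (ltW l1P)))// mulrCA ler_piMr//; first lra.
by rewrite ler_pdivrMr//; lra.
Qed.

Lemma approximable0 : approximable 0.
Proof. by move=> e e0; exists [::]; rewrite /combination big_nil subrr normr0. Qed.

Lemma approximable_closed : approx_closed approximable.
Proof.
move=> x h e e0.
have [|y [ay xy]] := h (e / 2); first by rewrite divr_gt0.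
have [|l lP] := ay (e / 2); first by rewrite divr_gt0.
exists l; have := ler_normD (x - y) (y - combination l); rewrite subrKA; lra.
Qed.

End generators.

Section limit_pair.
Context {R : realType} {A : Type} {E F : normedModType R}.

(** The closure of the graph of [combination a l |-> combination b l]; as a relation it can be used
    before this map is known to be well defined. *)
Definition limit_pair (a : A -> E) (b : A -> F) x y := forall e, 0 < e ->
  exists l, `|x - combination a l| < e /\ `|y - combination b l| < e.

Lemma limit_pair_exists (a : A -> E) (b : A -> F) x :
  (forall l, `|combination a l| = `|combination b l|) ->
  geometric_complete F -> approximable a x -> exists y, limit_pair a b x y.
Proof.
move=> ab compF ax.
(* With the extra factor 1/2, two consecutive errors add up to less than [2^-1 ^+ n]. *)
have /choice[l lP] : forall n, exists l, `|x - combination a l| < 2^-1 ^+ n / 2.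
  by move=> n; apply: ax; rewrite divr_gt0// exprn_gt0// invr_gt0.
have bB l1 l2 : `|combination b l1 - combination b l2| = `|combination a l1 - combination a l2|.
  have := ab ([seq (-1 * p.1, p.2) | p <- l2] ++ l1).
  by rewrite !combinationZD !scaleN1r ![- _ + _]addrC.
have [n|y yP] := compF (fun n => combination b (l n)).
  rewrite bB.
  have := ler_normD (combination a (l n.+1) - x) (x - combination a (l n)).
  rewrite subrKA (distrC _ x); have := lP n; have := lP n.+1; rewrite exprS.
  by have : 0 <= 2^-1 ^+ n :> R; [rewrite exprn_ge0// invr_ge0|lra].
exists y => e e0.
have [N1 N1P] := half_expr_lt e0; have [N2 N2P] := yP e e0.
exists (l (maxn N1 N2)); split.
  have := lP (maxn N1 N2); have := N1P _ (leq_maxl N1 N2).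
  by have := normr_ge0 (x - combination a (l (maxn N1 N2))); lra.
by rewrite distrC N2P// leq_maxr.
Qed.

End limit_pair.

Section isometry_of_generators.
Context {R : realType} {A : Type} {E F : normedModType R}.
Variables (a : A -> E) (b : A -> F).
Hypothesis ab : forall l, `|combination a l| = `|combination b l|.

Lemma limit_pair_norm x y : limit_pair a b x y -> `|x| = `|y|.
Proof.
move=> xy; apply/eqP; rewrite eq_le; apply/andP; split; apply/ler_addgt0Pr => e e0;
have [|l [xl yl]] := xy (e / 2); rewrite ?divr_gt0//.
  have := ler_normD (x - combination a l) (combination a l); rewrite subrK ab.
  have := ler_normD (combination b l - y) y; rewrite subrK distrC; lra.
have := ler_normD (y - combination b l) (combination b l); rewrite subrK -ab.
have := ler_normD (combination a l - x) x; rewrite subrK distrC; lra.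
Qed.

Lemma limit_pair_lin (t : R) x x' y y' : limit_pair a b x y -> limit_pair a b x' y' ->
  limit_pair a b (t *: x + x') (t *: y + y').
Proof.
move=> xy xy' e e0.
have t1 : 0 < `|t| + 1 by have := normr_ge0 t; lra.
have [|l1 [x1 y1]] := xy (e / 2 / (`|t| + 1)); first by rewrite !divr_gt0.
have [|l2 [x2 y2]] := xy' (e / 2); first by rewrite divr_gt0.
have small : `|t| * (e / 2 / (`|t| + 1)) <= e / 2.
  rewrite mulrCA ler_piMr//; first lra.
  by rewrite ler_pdivrMr//; lra.
exists ([seq (t * p.1, p.2) | p <- l1] ++ l2); rewrite !combinationZD; split.
  have -> : t *: x + x' - (t *: combination a l1 + combination a l2) =
    t *: (x - combination a l1) + (x' - combination a l2) by lmodule_eq.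
  rewrite (le_lt_trans (ler_normD _ _))// normrZ (splitr e) ler_ltD//.
  exact: le_trans (ler_wpM2l (normr_ge0 t) (ltW x1)) small.
have -> : t *: y + y' - (t *: combination b l1 + combination b l2) =
  t *: (y - combination b l1) + (y' - combination b l2) by lmodule_eq.
rewrite (le_lt_trans (ler_normD _ _))// normrZ (splitr e) ler_ltD//.
exact: le_trans (ler_wpM2l (normr_ge0 t) (ltW y1)) small.
Qed.

(** Limit pairs form a linear relation whose two members have equal norm, so each determines the
    other; density and completeness make the relation total on both sides. *)
Lemma isometry_of_generators : geometric_complete E -> geometric_complete F ->
  (forall x, approximable a x) -> (forall y, approximable b y) ->
  linearly_isometric E F.
Proof.
move=> compE compF spanE spanF.
have /choice[J JP] : forall x, exists y, limit_pair a b x y.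
  by move=> x; exact: limit_pair_exists.
have /choice[K KP] : forall y, exists x, limit_pair a b x y.
  move=> y; have [x xy] := limit_pair_exists (fun l => esym (ab l)) compE (spanF y).
  by exists x => e /xy[l [? ?]]; exists l.
have uniqr x y y' : limit_pair a b x y -> limit_pair a b x y' -> y = y'.
  move=> xy xy'; have := limit_pair_norm (limit_pair_lin (-1) xy xy').
  rewrite !scaleN1r addNr normr0 => /esym/eqP; rewrite normr_eq0 addrC subr_eq0.
  by move/eqP.
have uniql x x' y : limit_pair a b x y -> limit_pair a b x' y -> x = x'.
  move=> xy xy'; have := limit_pair_norm (limit_pair_lin (-1) xy xy').
  rewrite !scaleN1r addNr normr0 => /eqP; rewrite normr_eq0 addrC subr_eq0.
  by move/eqP.
have lJ : linear J.
  by move=> t x y; apply: uniqr (JP _) _; exact: limit_pair_lin.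
pose JL : {linear E -> F} := HB.pack J (GRing.isLinear.Build _ _ _ _ _ lJ).
exists JL; split; last by move=> x; apply/esym; exact: limit_pair_norm (JP x).
by exists K => [x|y]; [exact: uniql (KP (J x)) (JP x)|exact: uniqr (JP (K y)) (KP y)].
Qed.

End isometry_of_generators.

Lemma represents_indic d (T : measurableType d) (R : realType)
    (mu : {measure set T -> \bar R}) (A : set T) :
  measurable A -> (mu A < +oo)%E -> exists F : LspaceType1 mu, represents F (\1_A).
Proof.
move=> mA finA; apply: represents_exists; apply/integrableP; split.
  by apply/measurable_EFinP; exact: measurable_indic.
rewrite (eq_integral (fun x => (\1_A x)%:E)); last first.
  by move=> x _ /=; rewrite ger0_norm.
by rewrite integral_indic// setIT.
Qed.

(** Density of integrable simple functions as an induction principle: such a function is a finite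
    sum over its values, and its level sets at nonzero values have finite measure. *)
Lemma L1_span d (T : measurableType d) (R : realType)
    (mu : {measure set T -> \bar R}) (M : set (LspaceType1 mu)) :
  (forall A F, measurable A -> (mu A < +oo)%E -> represents F (\1_A) -> M F) ->
  M 0 -> (forall (t : R) F G, M F -> M G -> M (t *: F + G)) -> approx_closed M ->
  forall F, M F.
Proof.
move=> Mind M0 Mlin Mcl F; apply: Mcl => e e0.
have [g [ig _ gF]] :=
  approximation_sfun_integrable measurableT (L1_fun_integrable F).
have [n gn] : exists n, (\int[mu]_x `|(L1_fun F x)%:E - (g n x)%:E| < e%:E)%E.
  move: gF => /fine_cvgP[fin /cvgrPdist_lt /(_ e e0) small].
  near \oo => n; exists n.
  have finn : (\int[mu]_x `|(L1_fun F x)%:E - (g n x)%:E|)%E \is a fin_num.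
    by near: n.
  rewrite -(fineK finn) lte_fin.
  have : `|0 - fine (\int[mu]_x `|(L1_fun F x)%:E - (g n x)%:E|)%E| < e by near: n.
  by rewrite sub0r normrN; apply: le_lt_trans; exact: ler_norm.
have [H HP] := represents_exists (ig n).
exists H; split; last first.
  rewrite -lte_fin (@represents_norm _ _ _ _ _ (L1_fun F \- g n)).
  - by under eq_integral do rewrite EFinB.
  - by apply: measurable_funB => //; exact: L1_fun_measurable.
  - by apply: representsB => //; exact: L1_fun_represents.
(* Chebyshev: [|y|] times the measure of the level set is at most the integral of the absolute value
   of [g n]. *)
have fin_level y : y != 0 -> (mu (g n @^-1` [set y]) < +oo)%E.
  move=> y0; have mA : measurable (g n @^-1` [set y]) by exact: measurable_sfunP.
  have /integrableP[_ gfin] := ig n.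
  have : (`|y|%:E * mu (g n @^-1` [set y]) < +oo)%E.
    rewrite -integral_cst//; apply: le_lt_trans gfin.
    rewrite (eq_integral (fun x => `|(EFin \o g n) x|%E)); last first.
      by move=> x; rewrite inE /= => ->.
    by apply: ge0_subset_integral => //; apply: measurableT_comp => //; exact/measurable_EFinP.
  rewrite !ltey; apply: contra => /eqP ->.
  by rewrite mulry gtr0_sg ?mul1e// normr_gt0.
have /choice[G GP] : forall y, exists G, M G /\
    represents (y *: G) (fun x => y * \1_(g n @^-1` [set y]) x).
  (* The level set of 0 may have infinite measure, so the value 0 gets [G = 0]. *)
  move=> y; have [->|y0] := eqVneq y 0.
    exists 0; split=> //; rewrite scaler0.
    by under eq_fun do rewrite mul0r; exact: represents0.
  have mA : measurable (g n @^-1` [set y]) by exact: measurable_sfunP.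
  have [G GA] := represents_indic mA (fin_level y y0).
  by exists G; split; [exact: (Mind _ _ mA (fin_level y y0) GA)|exact: representsZ].
pose s : seq R := finmap.enum_fset (fset_set (range (g n))).
have -> : H = \sum_(y <- s) y *: G y.
  apply: (represents_unique HP).
  have := represents_sum s (fun y => (GP y).2).
  congr represents; apply/funext => x.
  by rewrite [RHS]fimfunE fsbig_finite.
elim: s => [|y s IH]; first by rewrite big_nil.
by rewrite big_cons; apply: Mlin => //; exact: (GP y).1.
Unshelve. all: by end_near. Qed.

(** Both spaces are generated by the same index set [{s | S s}]: by [s] itself in [E], by the
    indicator of [h s] in the L1 space. In the latter, the indicator of a set of finite measure is
    close to that of some [h s] because their symmetric difference is small. *)
Theorem L1_representation (R : realType) (E : normedModType R) :
  geometric_complete E -> norm_decomposition E 4 ->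
  exists (d : measure_display) (T : measurableType d) (mu : {measure set T -> \bar R}),
    linearly_isometric E (LspaceType1 mu).
Proof.
move=> compE decE.
have [C maxC] := @maximal_additive_cone_exists R E.
have [S maxS] := maximal_compatible_family_exists maxC compE decE.
have [d [T [nu [h [hP h0 hI hD hreg]]]]] := stone_measure maxS.
exists d, T, nu.
have /choice[b bP] : forall s : {s | S s}, exists F : LspaceType1 nu,
    represents F (\1_(h (sval s))).
  move=> [s Ss]; have [mh nuh] := hP s Ss.
  by apply: represents_indic => //; rewrite nuh ltry.
apply: (@isometry_of_generators _ _ _ _ (fun s : {s | S s} => sval s) b) => //.
- move=> l; apply: EFin_inj; rewrite /combination.
  rewrite -(combination_norm maxS l hP hI hD); apply/esym.
  rewrite (@represents_norm _ _ _ _ _ (fun x => \sum_(p <- l) p.1 * \1_(h (sval p.2)) x))//.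
    apply: measurable_sum => p; apply: measurable_funM => //.
    by apply: measurable_indic; exact: (hP _ (svalP p.2)).1.
  by apply: represents_sum => p; exact: representsZ.
- exact: L1_geometric_complete.
- apply: (family_span maxS).
  + by move=> s Ss; exact: (approximable_generator _ (exist _ s Ss)).
  + exact: approximable_lin.
  + exact: approximable_closed.
- apply: L1_span.
  + move=> A F mA finA FA; apply: approximable_closed => e e0.
    have [|s Ss As] := hreg A mA finA (e / 2); first by rewrite divr_gt0.
    exists (b (exist _ s Ss)); split; first exact: approximable_generator.
    have [mh nuh] := hP s Ss.
    rewrite -lte_fin (@represents_norm _ _ _ _ _ (\1_A \- \1_(h s))); last first.
    - exact: representsB FA (bP (exist _ s Ss)).
    - by apply: measurable_funB; exact: measurable_indic.
    apply: (@le_lt_trans _ _ (e / 2)%:E); last by rewrite lte_fin; lra.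
    apply: le_trans As.
    have mAs : measurable (A `\` h s) by exact: measurableD.
    have msA : measurable (h s `\` A) by exact: measurableD.
    rewrite -(setIT (A `\` h s)) -(setIT (h s `\` A)) -!integral_indic//.
    rewrite -ge0_integralD//; last 2 first.
      by apply/measurable_EFinP; exact: measurable_indic.
      by apply/measurable_EFinP; exact: measurable_indic.
    rewrite le_eqVlt; apply/orP; left; apply/eqP; apply: eq_integral => x _.
    rewrite -EFinD /= !indicE !in_setD; congr (_%:E).
    by case: (x \in A); case: (x \in h s); 
      rewrite /= ?subrr ?subr0 ?sub0r ?normrN ?normr0 ?normr1 ?addr0 ?add0r.
  + exact: approximable0.
  + exact: approximable_lin.
  + exact: approximable_closed.
Qed.

Theorem corollary3p7 (R : realType) (X Y : completeNormedModType R) :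
  (forall eps : R, 0 < eps ->
     exists (phi : X -> Y) (psi : Y -> X),
       [/\ cancel phi psi, cancel psi phi, lipschitz phi, lipschitz psi
         & lipschitz_norm phi * lipschitz_norm psi <= 1 + eps]) ->
  L1_predual X -> L1_predual Y.
Proof.
move=> equiv [d [T [mu isoX]]].
have decX : norm_decomposition (dual X) 4.
  by apply: (norm_decomposition_isometry isoX); exact: L1_norm_decomposition.
apply: L1_representation; first exact: dual_geometric_complete.
apply: decomposition_of_balls.
exact: almost_intersecting_balls_lipschitz equiv (balls_of_decomposition decX).
Qed.
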